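(* Let $(M^2,g)$ be a connected, oriented pseudo-Riemannian (possibly Riemannian) 2-manifold with Levi-Civita connection $\nabla$ and natural volume form $\Omega$; let $\omega=1$ if $g$ has signature $(++)$ or $(--)$ and $\omega=-1$ if $g$ has signature $(+-)$. Let $\alpha\colon I\to M^2$ be a smooth curve such that $g(\alpha',\alpha')\neq0$ and $\Omega(\alpha',\nabla_{\alpha'}\alpha')\ne0$ everywhere on $I$, and let $\nu=|g(\alpha',\alpha')|^{1/2}$. Then the equi-affine curvature $\kappa_a$ and the Frenet curvature $\kappa_r$ of $\alpha$ are related by $$\kappa_a=\frac{1}{9\,\kappa_r^{8/3}}\Big(3\nu^{-2}\kappa_r\kappa_r''-5\nu^{-2}(\kappa_r')^2-3\nu^{-3}\nu'\kappa_r\kappa_r'+9\omega\kappa_r^4\Big).$$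
   Context: The natural volume form $\Omega$ of $(M^2,g)$ is the 2-form compatible with the orientation given in positively oriented local coordinates $(x^1,x^2)$ by $\Omega=\sqrt{|G|}\,(dx^1\otimes dx^2-dx^2\otimes dx^1)$, where $G=g_{11}g_{22}-g_{12}^2$ (so $\Omega(u,v)=\pm1$ for orthonormal $u,v$, positive when $(u,v)$ is positively oriented). It is parallel with respect to $\nabla$. For a smooth curve $\alpha\colon I\to M^2$ ($I$ an open interval), $\nabla_{\alpha'}$ is covariant differentiation along $\alpha$ with respect to the parameter $t\in I$, and $\nabla^2_{\alpha'}\alpha'=\nabla_{\alpha'}(\nabla_{\alpha'}\alpha')$. Primes on functions on $I$ denote derivatives in $t$. Powers with exponents in $\frac13\mathbb Z$ are taken via the real cube root: $x^{m/3}=(\sqrt[3]{x})^m$, for $x$ possibly negative. Frenet curvature: define the $(1,1)$-tensor field $J$ by $g(X,JY)=\Omega(X,Y)$. If $g(\alpha',\alpha')\ne0$ everywhere, put $\mathbf T=\alpha'/\nu$, $\varepsilon=g(\mathbf T,\mathbf T)\in\{1,-1\}$, $\mathbf N=-\omega\varepsilon J\mathbf T$ (the unique unit vector field along $\alpha$ orthogonal to $\mathbf T$ with $(\mathbf T,\mathbf N)$ positively oriented), and $\nabla_{\mathbf T}=\nu^{-1}\nabla_{\alpha'}$. The Frenet curvature $\kappa_r\colon I\to\mathbb R$ is the unique function with $\nabla_{\mathbf T}\mathbf T=\kappa_r\mathbf N$. Equi-affine curvature: if $\Omega(\alpha',\nabla_{\alpha'}\alpha')\ne0$ everywhere, put $\mu=\sqrt[3]{\Omega(\alpha',\nabla_{\alpha'}\alpha')}$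 and, for some $t_0\in I$, $\sigma(t)=\int_{t_0}^t\mu(u)\,du$. Then $\sigma'=\mu\neq0$, so $\sigma\colon I\to\sigma(I)$ is a diffeomorphism onto an open interval; let $\overline\alpha\colon\sigma(I)\to M^2$ be the reparametrization with $\alpha=\overline\alpha\circ\sigma$. It satisfies $\Omega(\overline\alpha',\nabla_{\overline\alpha'}\overline\alpha')=1$, hence $\Omega(\overline\alpha',\nabla^2_{\overline\alpha'}\overline\alpha')=0$, so there is a unique function $\overline\kappa_a$ on $\sigma(I)$ with $\nabla^2_{\overline\alpha'}\overline\alpha'=-\overline\kappa_a\,\overline\alpha'$. The equi-affine curvature of $\alpha$ is $\kappa_a=\overline\kappa_a\circ\sigma\colon I\to\mathbb R$ (independent of $t_0$). *)

(* Defs.v *)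
(* Stdlib real numbers with Coquelicot. *)
From Stdlib Require Import Reals List ClassicalEpsilon Lra.
From Coquelicot Require Import Coquelicot.
Set Implicit Arguments.
Open Scope R_scope.

(** * Calculus on the plane *)

Inductive idx := x1 | x2.

Definition coord (i : idx) (v : R * R) : R :=
  match i with x1 => fst v | x2 => snd v end.

Definition vec (f : idx -> R) : R * R := (f x1, f x2).

Definition sum2 (f : idx -> R) : R := f x1 + f x2.

Definition partial (i : idx) (f : R * R -> R) (p : R * R) : R :=
  match i with
  | x1 => Derive (fun x => f (x, snd p)) (fst p)
  | x2 => Derive (fun y => f (fst p, y)) (snd p)
  end.

Definition ex_partial (i : idx) (f : R * R -> R) (p : R * R) : Prop :=
  match i with
  | x1 => ex_derive (fun x => f (x, snd p)) (fst p)
  | x2 => ex_derive (fun y => f (fst p, y)) (snd p)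
  end.

Fixpoint partials (l : list idx) (f : R * R -> R) : R * R -> R :=
  match l with
  | nil => f
  | i :: l' => partial i (partials l' f)
  end.

(** Used only for open [U], so the values of [f] outside [U] are irrelevant. *)
Definition smooth_on (U : R * R -> Prop) (f : R * R -> R) : Prop :=
  forall (l : list idx) (p : R * R), U p ->
    continuous (partials l f) p /\ forall i, ex_partial i (partials l f) p.

(** * Oriented surfaces *)

(** A smooth oriented atlas on the set [M]: charts are bijections from [dom a]
    onto open subsets of the plane and all transition maps are smooth with
    positive Jacobian.  The topology of [M] is the one induced by the charts
    ([is_open] below).  [chart_at] picks a chart around each point; it is only
    used to evaluate expressions that do not depend on the chart. *)
Record oriented_atlas (M : Type) := {
  index : Type;
  dom : index -> M -> Prop;
  chart : index -> M -> R * R;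
  chart_inv : index -> R * R -> M;
  chart_at : M -> index;
  overlap (a b : index) (x : R * R) : Prop :=
    exists p, dom a p /\ dom b p /\ chart a p = x;
  transition (a b : index) (x : R * R) : R * R := chart b (chart_inv a x);
  chart_at_dom : forall p, dom (chart_at p) p;
  chartK : forall a p, dom a p -> chart_inv a (chart a p) = p;
  overlap_open : forall a b, open (overlap a b);
  transition_smooth : forall a b k,
    smooth_on (overlap a b) (fun x => coord k (transition a b x));
  transition_oriented : forall a b x, overlap a b x ->
    let D i k := partial i (fun y => coord k (transition a b y)) x in
    0 < D x1 x1 * D x2 x2 - D x1 x2 * D x2 x1
}.

Section Topology.
Context {M : Type} (A : oriented_atlas M).

Definition chart_image (a : index A) (x : R * R) : Prop :=
  exists p, dom A a p /\ chart A a p = x.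

Definition is_open (W : M -> Prop) : Prop :=
  forall a, open (fun x => exists p, dom A a p /\ W p /\ chart A a p = x).

Definition hausdorff : Prop :=
  forall p q, p <> q -> exists V W, is_open V /\ is_open W /\ V p /\ W q /\
    forall r, ~ (V r /\ W r).

Definition second_countable : Prop :=
  exists B : nat -> M -> Prop, (forall n, is_open (B n)) /\
    forall W p, is_open W -> W p -> exists n, B n p /\ forall q, B n q -> W q.

Definition connected_space : Prop :=
  forall W, is_open W -> is_open (fun p => ~ W p) ->
    (forall p, W p) \/ (forall p, ~ W p).

(** [dtrans a b i k x] is the derivative of the [k]-th coordinate of chart [b]
    with respect to the [i]-th coordinate of chart [a]. *)
Definition dtrans (a b : index A) (i k : idx) (x : R * R) : R :=
  partial i (fun y => coord k (transition A a b y)) x.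

End Topology.

(** * Pseudo-Riemannian metrics *)

Inductive signature := PlusPlus | MinusMinus | PlusMinus.

Definition sig_diag (s : signature) (i : idx) : R :=
  match s, i with
  | PlusPlus, _ => 1
  | MinusMinus, _ => -1
  | PlusMinus, x1 => 1
  | PlusMinus, x2 => -1
  end.

Definition bilin (h : idx -> idx -> R) (u v : R * R) : R :=
  sum2 (fun i => sum2 (fun j => h i j * coord i u * coord j v)).

(** [gij a i j] is the component g_ij in chart [a], as a function of the
    coordinates.  The existence of an orthonormal basis at every point
    ([g_signature]) contains nondegeneracy and constancy of the index. *)
Record pseudo_metric (M : Type) (A : oriented_atlas M) := {
  gij : index A -> idx -> idx -> R * R -> R;
  sig : signature;
  g_smooth : forall a i j, smooth_on (chart_image A a) (gij a i j);
  g_sym : forall a i j x, chart_image A a x -> gij a i j x = gij a j i x;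
  g_tensor : forall a b i j x, overlap A a b x ->
    gij a i j x =
    sum2 (fun k => sum2 (fun l =>
      dtrans A a b i k x * dtrans A a b j l x * gij b k l (transition A a b x)));
  g_signature : forall a x, chart_image A a x ->
    exists e1 e2 : R * R,
      let g0 := bilin (fun i j => gij a i j x) in
      g0 e1 e1 = sig_diag sig x1 /\ g0 e1 e2 = 0 /\ g0 e2 e2 = sig_diag sig x2
}.

Section Metric.
Context {M : Type} {A : oriented_atlas M} (g : pseudo_metric A).

Definition omega : R :=
  match sig g with PlusPlus | MinusMinus => 1 | PlusMinus => -1 end.

Definition metric (a : index A) (x u v : R * R) : R :=
  bilin (fun i j => gij g a i j x) u v.

Definition gram (a : index A) (x : R * R) : R :=
  gij g a x1 x1 x * gij g a x2 x2 x - gij g a x1 x2 x ^ 2.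

Definition vol (a : index A) (x u v : R * R) : R :=
  sqrt (Rabs (gram a x)) * (fst u * snd v - snd u * fst v).

(** The tensor J, determined by g(u, J v) = Omega(u, v) for all u. *)
Definition Jop (a : index A) (x v : R * R) : R * R :=
  epsilon (inhabits (0, 0)) (fun w => forall u, metric a x u w = vol a x u v).

End Metric.

(** * Affine connections *)

(** [Gam a k i j] is the Christoffel symbol Gamma^k_ij in chart [a], i.e. the
    [k]-th component of the covariant derivative of the [j]-th coordinate
    vector field along the [i]-th one.  [Gam_law] expresses that the local
    formulas define one covariant derivative on [M]. *)
Record affine_connection (M : Type) (A : oriented_atlas M) := {
  Gam : index A -> idx -> idx -> idx -> R * R -> R;
  Gam_smooth : forall a k i j, smooth_on (chart_image A a) (Gam a k i j);
  Gam_law : forall a b k i j x, overlap A a b x ->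
    sum2 (fun l => dtrans A a b l k x * Gam a l i j x) =
    partial i (dtrans A a b j k) x +
    sum2 (fun l => sum2 (fun m =>
      Gam b k l m (transition A a b x) * dtrans A a b i l x * dtrans A a b j m x))
}.

(** Torsion-free and metric. *)
Definition levi_civita (M : Type) (A : oriented_atlas M)
    (g : pseudo_metric A) (nabla : affine_connection A) : Prop :=
  (forall a k i j x, chart_image A a x ->
     Gam nabla a k i j x = Gam nabla a k j i x) /\
  (forall a k i j x, chart_image A a x ->
     partial k (gij g a i j) x =
     sum2 (fun l => Gam nabla a l k i x * gij g a l j x
                    + Gam nabla a l k j x * gij g a i l x)).

(** * Curves *)

Definition Rbar_interval (l r : Rbar) (t : R) : Prop := Rbar_lt l t /\ Rbar_lt t r.

(** The real cube root, also for negative arguments. *)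
Definition cbrt (x : R) : R := sign x * Rpower (Rabs x) (/ 3).

Lemma cbrt_pow3 (x : R) : cbrt x ^ 3 = x.
Proof.
  assert (H : forall y, 0 < y -> Rpower y (/ 3) ^ 3 = y).
  { intros y Hy.
    rewrite <- Rpower_pow by (unfold Rpower; apply exp_pos).
    rewrite Rpower_mult.
    replace (/ 3 * INR 3) with 1 by (simpl; field).
    now apply Rpower_1. }
  unfold cbrt; rewrite Rpow_mult_distr.
  destruct (Rtotal_order x 0) as [Hx | [Hx | Hx]].
  - rewrite sign_eq_m1, Rabs_left, H by lra; ring.
  - subst x; rewrite sign_0; ring.
  - rewrite sign_eq_1, Rabs_right, H by lra; ring.
Qed.

Section Curve.
Context {M : Type} {A : oriented_atlas M}.
Context (g : pseudo_metric A) (nabla : affine_connection A).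

(** A curve is a total function of which only the restriction to an open
    interval [D] matters. *)
Definition smooth_curve (D : R -> Prop) (alpha : R -> M) : Prop :=
  (forall W t, is_open A W -> D t -> W (alpha t) ->
     locally t (fun s => W (alpha s))) /\
  (forall a t k n, D t -> dom A a (alpha t) ->
     ex_derive_n (fun s => coord k (chart A a (alpha s))) n t).

(** A vector field along a curve is given by its components in all charts;
    [V a t] is meaningful only if [dom A a (alpha t)]. *)
Definition vfield : Type := index A -> R -> R * R.

(** Equality at time [t] of two vector fields along [alpha]. *)
Definition eq_at (alpha : R -> M) (t : R) (V W : vfield) : Prop :=
  forall a, dom A a (alpha t) -> V a t = W a t.

Definition rescale (f : R -> R) (V : vfield) : vfield :=
  fun a t => scal (f t) (V a t).

Definition velocity (alpha : R -> M) : vfield :=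
  fun a t => vec (fun k => Derive (fun s => coord k (chart A a (alpha s))) t).

(** Covariant differentiation along [alpha] with respect to the parameter. *)
Definition cov (alpha : R -> M) (V : vfield) : vfield :=
  fun a t => vec (fun k =>
    Derive (fun s => coord k (V a s)) t +
    sum2 (fun i => sum2 (fun j =>
      Gam nabla a k i j (chart A a (alpha t))
      * coord i (velocity alpha a t) * coord j (V a t)))).

Definition metric_along (alpha : R -> M) (V W : vfield) (t : R) : R :=
  let a := chart_at A (alpha t) in
  metric g a (chart A a (alpha t)) (V a t) (W a t).

Definition vol_along (alpha : R -> M) (V W : vfield) (t : R) : R :=
  let a := chart_at A (alpha t) in
  vol g a (chart A a (alpha t)) (V a t) (W a t).

Definition J_along (alpha : R -> M) (V : vfield) : vfield :=
  fun a t => Jop g a (chart A a (alpha t)) (V a t).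

(** ** Frenet curvature *)

Definition speed (alpha : R -> M) (t : R) : R :=
  sqrt (Rabs (metric_along alpha (velocity alpha) (velocity alpha) t)).

Definition tangent (alpha : R -> M) : vfield :=
  rescale (fun t => / speed alpha t) (velocity alpha).

Definition causal_sign (alpha : R -> M) : R -> R :=
  metric_along alpha (tangent alpha) (tangent alpha).

Definition normal (alpha : R -> M) : vfield :=
  rescale (fun t => - omega g * causal_sign alpha t)
          (J_along alpha (tangent alpha)).

Definition frenet_curvature (alpha : R -> M) (t : R) : R :=
  epsilon (inhabits 0) (fun k =>
    eq_at alpha t
      (rescale (fun s => / speed alpha s) (cov alpha (tangent alpha)))
      (rescale (fun _ => k) (normal alpha))).

(** ** Equi-affine curvature *)

Definition ea_speed (alpha : R -> M) (t : R) : R :=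
  cbrt (vol_along alpha (velocity alpha) (cov alpha (velocity alpha)) t).

Definition ea_param (alpha : R -> M) (t0 t : R) : R :=
  RInt (ea_speed alpha) t0 t.

(** The curve [beta] on the image of [D] with [beta (ea_param alpha t0 t) = alpha t]
    for [t] in [D]. *)
Definition ea_reparam (D : R -> Prop) (alpha : R -> M) (t0 s : R) : M :=
  alpha (epsilon (inhabits t0) (fun t => D t /\ ea_param alpha t0 t = s)).

Definition unit_ea_curvature (beta : R -> M) (s : R) : R :=
  epsilon (inhabits 0) (fun k =>
    eq_at beta s
      (cov beta (cov beta (velocity beta)))
      (rescale (fun _ => - k) (velocity beta))).

Definition equi_affine_curvature
    (D : R -> Prop) (alpha : R -> M) (t0 t : R) : R :=
  unit_ea_curvature (ea_reparam D alpha t0) (ea_param alpha t0 t).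

End Curve.

(* Main.v *)
Require Import Defs.
From Stdlib Require Import Reals.
From Coquelicot Require Import Coquelicot.
From Stdlib Require Import Lra Ranalysis5 ClassicalEpsilon.
Open Scope R_scope.

(** Write [q = g(alpha', alpha')], [w = Omega(alpha', nabla alpha')],
    [nu = |q|^(1/2)] and [mu = w^(1/3)].

    Everything is measured against the single non-null field [alpha']: a vector
    is determined by its [g]- and [Omega]-products with [alpha']
    ([vector_ext]).  Since [g] and [Omega] are both parallel ([is_derive_metric],
    [is_derive_vol]), such products can be differentiated along the curve.

    Frenet side.  [q' = 2 g(alpha', nabla alpha')] gives
    [g(alpha', nabla alpha') = q nu'/nu]; hence [nabla_T T] is orthogonal to
    [alpha'], and comparing its [Omega]-product with that of the normal yields
    [kappa_r = w / nu^3] ([frenet_curvature_eq]).  With [c = kappa_r^(1/3)] this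
    says [mu = nu c], and no fractional power is left.

    Equi-affine side.  The map [t |-> sigma(t)] has the derivative [mu], so
    covariant differentiation along the reparametrized curve [beta] is the
    operator [mu^-1 nabla] along [alpha] ([cov_reparam]), and the first three
    derivatives of [beta] are
    [B1 = mu^-1 alpha'], [B2 = mu^-1 nabla B1], [B3 = mu^-1 nabla B2].
    Leibniz's rule gives [Omega(alpha', B2) = mu] and
    [g(alpha', B2) = - q c' / (nu^2 c^3)].  Differentiating these two functions
    once more gives the products of [alpha'] with [B3]; the only new quantity is
    [g(nabla alpha', nabla alpha')], which the Gram identity
    [g(u,u) g(v,v) - g(u,v)^2 = omega Omega(u,v)^2] expresses by [q], [nu'] and
    [w].  This is where [omega] enters.  The outcome is
    [B3 = - kappa_a B1] with
    [kappa_a = (c'' - 3 c'^2/c - nu' c'/nu) / (nu^2 c^3) + omega c^4]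
    ([ea_jerk]), and substituting [kappa_r = c^3] gives the theorem
    ([curvature_from_root_eq]).

    The curvatures are defined by equations in every chart, while speed and
    [Omega]-products are evaluated in one chart chosen separately at each point.
    The two agree because [alpha'] and [nabla alpha'] transform by the Jacobian
    of the transition map ([velocity_push], [acceleration_push]) and [g],
    [Omega] are invariant under it ([metric_push], [vol_push]). *)

(** * Smooth functions of one real variable *)

(** Iterating the total derivative keeps each closure property below a one-step
    induction, and over an open [U] the neighbourhoods never appear. *)
Fixpoint differentiable_times (n : nat) (U : R -> Prop) (f : R -> R) : Prop :=
  match n with
  | O => True
  | S n' => (forall s, U s -> ex_derive f s) /\
            differentiable_times n' U (Derive f)
  end.

Definition smooth (U : R -> Prop) (f : R -> R) : Prop :=
  forall n, differentiable_times n U f.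

Lemma open_eq_locally (U : R -> Prop) (f h : R -> R) (s : R) :
  open U -> (forall u, U u -> f u = h u) -> U s -> locally s (fun u => f u = h u).
Proof.
  intros HU E Hs. exact (filter_imp _ _ E (HU s Hs)).
Qed.

Section SmoothFunctions.
Variable U : R -> Prop.
Hypothesis U_open : open U.

Lemma differentiable_times_ext (n : nat) (f h : R -> R) :
  (forall s, U s -> f s = h s) ->
  differentiable_times n U f -> differentiable_times n U h.
Proof.
  revert f h; induction n as [|n IH]; intros f h E; [easy|].
  intros [Hd Hn]; split.
  - intros s Hs. apply (ex_derive_ext_loc f); auto.
    now apply (open_eq_locally U).
  - apply (IH (Derive f)); auto.
    intros s Hs. apply Derive_ext_loc. now apply (open_eq_locally U).
Qed.

Lemma differentiable_times_S (n : nat) (f : R -> R) :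
  differentiable_times (S n) U f -> differentiable_times n U f.
Proof.
  revert f; induction n as [|n IH]; intros f [Hd Hn]; [easy|].
  split; [easy | now apply IH].
Qed.

Lemma differentiable_times_derive (n : nat) (f f' : R -> R) :
  (forall s, U s -> is_derive f s (f' s)) ->
  differentiable_times n U f' -> differentiable_times (S n) U f.
Proof.
  intros Hd Hn; split.
  - intros s Hs; exists (f' s); auto.
  - apply (differentiable_times_ext n f'); auto.
    intros s Hs; symmetry; apply is_derive_unique; auto.
Qed.

Lemma smooth_ext (f h : R -> R) :
  (forall s, U s -> f s = h s) -> smooth U f -> smooth U h.
Proof. intros E Hf n; exact (differentiable_times_ext n f h E (Hf n)). Qed.

Lemma smooth_ex_derive (f : R -> R) (s : R) : smooth U f -> U s -> ex_derive f s.
Proof. intros Hf; apply (Hf 1%nat). Qed.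

Lemma smooth_is_derive (f : R -> R) (s : R) :
  smooth U f -> U s -> is_derive f s (Derive f s).
Proof. intros Hf Hs; apply Derive_correct; now apply smooth_ex_derive. Qed.

Lemma smooth_Derive (f : R -> R) : smooth U f -> smooth U (Derive f).
Proof. intros Hf n; apply (Hf (S n)). Qed.

Lemma differentiable_times_const (n : nat) (c : R) :
  differentiable_times n U (fun _ => c).
Proof.
  revert c; induction n as [|n IH]; intros c; [easy|].
  apply (differentiable_times_derive n _ (fun _ => 0)); auto.
  intros s _. apply @is_derive_const.
Qed.

Lemma differentiable_times_plus (n : nat) (f h : R -> R) :
  differentiable_times n U f -> differentiable_times n U h ->
  differentiable_times n U (fun s => f s + h s).
Proof.
  revert f h; induction n as [|n IH]; intros f h; [easy|].
  intros [Df Nf] [Dh Nh].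
  apply (differentiable_times_derive n _ (fun s => Derive f s + Derive h s)).
  - intros s Hs. apply @is_derive_plus; apply Derive_correct; auto.
  - now apply IH.
Qed.

Lemma differentiable_times_mult (n : nat) (f h : R -> R) :
  differentiable_times n U f -> differentiable_times n U h ->
  differentiable_times n U (fun s => f s * h s).
Proof.
  revert f h; induction n as [|n IH]; intros f h; [easy|].
  intros Sf Sh.
  apply (differentiable_times_derive n _
           (fun s => Derive f s * h s + f s * Derive h s)).
  - intros s Hs.
    apply (is_derive_mult f h); try apply Derive_correct.
    + now apply Sf.
    + now apply Sh.
    + intros; apply Rmult_comm.
  - apply differentiable_times_plus; apply IH.
    + apply Sf.
    + now apply differentiable_times_S.
    + now apply differentiable_times_S.
    + apply Sh.
Qed.

(** The logarithmic derivative [v] of [u] need only be as smooth as required of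
    [u'], since every further derivative of [u] is [u] times a polynomial in
    derivatives of [v].  This covers all real powers, whatever the sign of the
    base, without differentiating them more than once. *)
Lemma differentiable_times_log_derivative (n : nat) (u v : R -> R) :
  (forall s, U s -> is_derive u s (u s * v s)) ->
  differentiable_times n U v -> differentiable_times n U u.
Proof.
  intros Hd; induction n as [|n IH]; intros Hv; [easy|].
  apply (differentiable_times_derive n _ _ Hd).
  apply differentiable_times_mult.
  - apply IH; now apply differentiable_times_S.
  - now apply differentiable_times_S.
Qed.

Lemma differentiable_times_inv (n : nat) (f : R -> R) :
  (forall s, U s -> f s <> 0) ->
  differentiable_times n U f -> differentiable_times n U (fun s => / f s).
Proof.
  intros H0; induction n as [|n IH]; intros Hf; [easy|].
  apply (differentiable_times_derive n _
           (fun s => -1 * (Derive f s * (/ f s * / f s)))).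
  - intros s Hs.
    replace (-1 * (Derive f s * (/ f s * / f s)))
      with (- Derive f s / (f s ^ 2)) by (field; auto).
    apply is_derive_inv; auto. apply Derive_correct. now apply Hf.
  - assert (Hi := IH (differentiable_times_S n f Hf)).
    repeat apply differentiable_times_mult; auto.
    + apply differentiable_times_const.
    + apply Hf.
Qed.

Lemma smooth_const (c : R) : smooth U (fun _ => c).
Proof. intros n; apply differentiable_times_const. Qed.

Lemma smooth_plus (f h : R -> R) :
  smooth U f -> smooth U h -> smooth U (fun s => f s + h s).
Proof. intros Hf Hh n; apply differentiable_times_plus; auto. Qed.

Lemma smooth_mult (f h : R -> R) :
  smooth U f -> smooth U h -> smooth U (fun s => f s * h s).
Proof. intros Hf Hh n; apply differentiable_times_mult; auto. Qed.

Lemma smooth_inv (f : R -> R) :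
  (forall s, U s -> f s <> 0) -> smooth U f -> smooth U (fun s => / f s).
Proof. intros H0 Hf n; apply differentiable_times_inv; auto. Qed.

Lemma smooth_log_derivative (u v : R -> R) :
  (forall s, U s -> is_derive u s (u s * v s)) -> smooth U v -> smooth U u.
Proof. intros Hd Hv n; eapply differentiable_times_log_derivative; eauto. Qed.

Lemma ex_derive_n_smooth (f : R -> R) :
  (forall n s, U s -> ex_derive_n f n s) -> smooth U f.
Proof.
  intros Hf n; revert f Hf; induction n as [|n IH]; intros f Hf; [easy|].
  split.
  - intros s Hs; exact (Hf 1%nat s Hs).
  - apply IH. intros k s Hs. destruct k as [|k]; [easy|].
    assert (H := Hf (S (S k)) s Hs). simpl in H |- *.
    eapply ex_derive_ext; [|exact H].
    clear; induction k as [|k IHk]; intros u; [easy|].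
    simpl. now apply Derive_ext.
Qed.

End SmoothFunctions.

(** The derivative is written as the function times a logarithmic derivative, the
    form that [smooth_log_derivative] takes and that is the same for both signs
    of [f]. *)
Lemma is_derive_sqrt_Rabs (f : R -> R) (s d : R) :
  is_derive f s d -> f s <> 0 ->
  is_derive (fun u => sqrt (Rabs (f u))) s
    (sqrt (Rabs (f s)) * (d * / (2 * f s))).
Proof.
  intros Hd H0.
  assert (Hp : 0 < Rabs (f s)) by now apply Rabs_pos_lt.
  assert (Hr := sqrt_lt_R0 _ Hp).
  evar_last; [apply is_derive_sqrt; [exact (is_derive_Rabs f s d Hd H0) | exact Hp]|].
  assert (E : sqrt (Rabs (f s)) * sqrt (Rabs (f s)) = Rabs (f s))
    by (apply sqrt_sqrt; lra).
  apply (Rmult_eq_reg_r (2 * sqrt (Rabs (f s)) * f s));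
    [|apply Rmult_integral_contrapositive_currified; [lra | exact H0]].
  replace (sqrt (Rabs (f s)) * (d * / (2 * f s)) * (2 * sqrt (Rabs (f s)) * f s))
    with ((sqrt (Rabs (f s)) * sqrt (Rabs (f s))) * d)
    by (field; repeat split; lra).
  rewrite E. unfold Rdiv.
  replace (sign (f s) * d * / (2 * sqrt (Rabs (f s))) * (2 * sqrt (Rabs (f s)) * f s))
    with (sign (f s) * f s * d) by (field; lra).
  f_equal. destruct (Rlt_or_le (f s) 0).
  - rewrite sign_eq_m1, Rabs_left; lra.
  - rewrite sign_eq_1, Rabs_right; lra.
Qed.

Lemma cbrt_neq_0 (x : R) : x <> 0 -> cbrt x <> 0.
Proof. intros Hx E; apply Hx; rewrite <- (cbrt_pow3 x), E; ring. Qed.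

Lemma is_derive_cbrt (f : R -> R) (s d : R) :
  is_derive f s d -> f s <> 0 ->
  is_derive (fun u => cbrt (f u)) s (cbrt (f s) * (d * / (3 * f s))).
Proof.
  intros Hd H0. 
  assert (Hp : 0 < Rabs (f s)) by now apply Rabs_pos_lt.
  apply (is_derive_ext_loc (fun u => sign (f s) * exp (/ 3 * ln (Rabs (f u))))).
  - assert (Hc : continuous f s) by (apply @ex_derive_continuous; now exists d).
    destruct (Rlt_or_le (f s) 0).
    + generalize (Hc _ (open_lt 0 (f s) H)). unfold filtermap.
      apply filter_imp. intros u Hu. unfold cbrt, Rpower.
      now rewrite (sign_eq_m1 (f u)), (sign_eq_m1 (f s)).
    + assert (H' : 0 < f s) by lra.
      generalize (Hc _ (open_gt 0 (f s) H')). unfold filtermap.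
      apply filter_imp. intros u Hu. unfold cbrt, Rpower.
      now rewrite (sign_eq_1 (f u)), (sign_eq_1 (f s)).
  - evar_last.
    + apply is_derive_scal. apply (is_derive_comp exp).
      * apply is_derive_exp.
      * apply is_derive_scal. apply (is_derive_comp ln).
        -- now apply is_derive_ln.
        -- exact (is_derive_Rabs f s d Hd H0).
    + unfold scal; simpl; unfold mult; simpl. unfold cbrt, Rpower.
      destruct (Rlt_or_le (f s) 0).
      * rewrite (sign_eq_m1 (f s)), Rabs_left by lra. field. lra.
      * rewrite (sign_eq_1 (f s)), Rabs_right by lra. field. lra.
Qed.

Lemma smooth_sqrt_Rabs (U : R -> Prop) (f : R -> R) :
  open U -> (forall s, U s -> f s <> 0) -> smooth U f ->
  smooth U (fun s => sqrt (Rabs (f s))).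
Proof.
  intros HU H0 Hf.
  apply (smooth_log_derivative U HU _ (fun s => Derive f s * / (2 * f s))).
  - intros s Hs; apply is_derive_sqrt_Rabs; auto. now apply (smooth_is_derive U).
  - apply smooth_mult; auto using smooth_Derive. apply smooth_inv; [exact HU| |].
    + intros s Hs; specialize (H0 s Hs); lra.
    + apply smooth_mult; auto using smooth_const.
Qed.

Lemma smooth_cbrt (U : R -> Prop) (f : R -> R) :
  open U -> (forall s, U s -> f s <> 0) -> smooth U f ->
  smooth U (fun s => cbrt (f s)).
Proof.
  intros HU H0 Hf.
  apply (smooth_log_derivative U HU _ (fun s => Derive f s * / (3 * f s))).
  - intros s Hs; apply is_derive_cbrt; auto. now apply (smooth_is_derive U).
  - apply smooth_mult; auto using smooth_Derive. apply smooth_inv; [exact HU| |].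
    + intros s Hs; specialize (H0 s Hs); lra.
    + apply smooth_mult; auto using smooth_const.
Qed.

(** * The chain rule in the plane *)

(** Split [f(u,v) - f(x,y)] at [(x,v)]: the mean value theorem handles the first
    variable near [(x,y)], and in the second one differentiability at the point
    suffices. *)
Lemma C1_differentiable (f : R * R -> R) (p : R * R) :
  locally p (ex_partial x1 f) -> continuous (partial x1 f) p ->
  ex_partial x2 f p ->
  differentiable_pt_lim (fun u v => f (u, v)) (fst p) (snd p)
    (partial x1 f p) (partial x2 f p).
Proof.
  destruct p as [x y]. intros H1 Hc H2 eps. simpl fst; simpl snd.
  simpl in H2. set (d2 := partial x2 f (x, y)).
  assert (He : 0 < eps / 2) by (destruct eps; simpl; lra).
  assert (Hd2 : is_derive (fun v => f (x, v)) y d2) by now apply Derive_correct.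
  destruct Hd2 as [_ Hd2]. specialize (Hd2 y (fun P H => H) (mkposreal _ He)).
  destruct Hd2 as [e2 He2].
  specialize (Hc _ (locally_ball (partial x1 f (x, y)) (mkposreal _ He))).
  unfold filtermap in Hc.
  destruct (filter_and _ _ H1 Hc) as [e1 He1].
  exists (mkposreal _ (Rmin_pos _ _ (cond_pos e1) (cond_pos e2))).
  intros u v Hu Hv. simpl in Hu, Hv.
  assert (Hu1 := Rlt_le_trans _ _ _ Hu (Rmin_l _ _)).
  assert (Hv1 := Rlt_le_trans _ _ _ Hv (Rmin_l _ _)).
  assert (Hv2 := Rlt_le_trans _ _ _ Hv (Rmin_r _ _)).
  destruct (MVT_cor4 (fun z => f (z, v)) (fun z => partial x1 f (z, v)) x (Rabs (u - x)))
    with (b := u) as [c [Ec Hc']].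
  - intros c Hc'. apply (Derive_correct (fun z => f (z, v))).
    apply (He1 (c, v)). split; simpl.
    + eapply Rle_lt_trans; [exact Hc' | exact Hu1].
    + exact Hv1.
  - apply Rle_refl.
  - replace (f (u, v) - f (x, y) - (partial x1 f (x, y) * (u - x) + d2 * (v - y)))
      with ((partial x1 f (c, v) - partial x1 f (x, y)) * (u - x)
            + (f (x, v) - f (x, y) - (v - y) * d2)).
    2:{ assert (f (u, v) = f (x, v) + partial x1 f (c, v) * (u - x)) as -> by lra. ring. }
    eapply Rle_trans; [apply Rabs_triang|].
    rewrite Rabs_mult.
    assert (B1 : Rabs (partial x1 f (c, v) - partial x1 f (x, y)) < eps / 2).
    { apply (He1 (c, v)). split; simpl.
      - eapply Rle_lt_trans; [exact Hc' | exact Hu1].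
      - exact Hv1. }
    assert (B2 : Rabs (f (x, v) - f (x, y) - (v - y) * d2) <= eps / 2 * Rabs (v - y))
      by exact (He2 v Hv2).
    assert (M1 := Rmax_l (Rabs (u - x)) (Rabs (v - y))).
    assert (M2 := Rmax_r (Rabs (u - x)) (Rabs (v - y))).
    assert (P1 := Rabs_pos (u - x)).
    assert (Q1 : Rabs (partial x1 f (c, v) - partial x1 f (x, y)) * Rabs (u - x)
                 <= eps / 2 * Rmax (Rabs (u - x)) (Rabs (v - y))).
    { apply Rmult_le_compat; auto using Rabs_pos. lra. }
    assert (Q2 : eps / 2 * Rabs (v - y)
                 <= eps / 2 * Rmax (Rabs (u - x)) (Rabs (v - y))).
    { apply Rmult_le_compat_l; lra. }
    lra.
Qed.

Lemma chain_rule (W : R * R -> Prop) (f : R * R -> R) (x : R -> R * R) (s : R)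
    (d : R * R) :
  open W -> smooth_on W f -> W (x s) ->
  (forall k, is_derive (fun u => coord k (x u)) s (coord k d)) ->
  is_derive (fun u => f (x u)) s (sum2 (fun k => partial k f (x s) * coord k d)).
Proof.
  intros HW Hf Hs Hx.
  apply (is_derive_ext (fun u => f (fst (x u), snd (x u)))).
  { intros u; now rewrite <- surjective_pairing. }
  apply is_derive_Reals.
  apply (derivable_pt_lim_comp_2d (fun u v => f (u, v))
           (fun u => fst (x u)) (fun u => snd (x u))).
  - apply C1_differentiable.
    + apply (filter_imp W); [|now apply HW].
      intros q Hq; apply (Hf nil q Hq).
    + apply (Hf (x1 :: nil)%list _ Hs).
    + apply (Hf nil _ Hs).
  - apply is_derive_Reals. exact (Hx x1).
  - apply is_derive_Reals. exact (Hx x2).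
Qed.

Lemma smooth_on_partial (W : R * R -> Prop) (f : R * R -> R) (k : idx) :
  smooth_on W f -> smooth_on W (partial k f).
Proof.
  intros Hf l p Hp.
  assert (E : forall l', partials l' (partial k f) = partials (l' ++ k :: nil)%list f).
  { induction l' as [|i l' IH]; simpl; [easy | now rewrite IH]. }
  rewrite E. now apply Hf.
Qed.

Lemma smooth_comp_plane (W : R * R -> Prop) (f : R * R -> R)
    (U : R -> Prop) (x : R -> R * R) :
  open W -> smooth_on W f -> open U -> (forall s, U s -> W (x s)) ->
  (forall k, smooth U (fun s => coord k (x s))) ->
  smooth U (fun s => f (x s)).
Proof.
  intros HW Hf HU HUW Hx n. revert f Hf; induction n as [|n IH]; intros f Hf; [easy|].
  apply (differentiable_times_derive U HU n _
    (fun s => sum2 (fun k => partial k f (x s) * Derive (fun u => coord k (x u)) s))).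
  - intros s Hs.
    pose (d := vec (fun k => Derive (fun u => coord k (x u)) s)).
    apply (chain_rule W f x s d); auto.
    intros k. replace (coord k d) with (Derive (fun u => coord k (x u)) s)
      by now destruct k.
    now apply (smooth_is_derive U).
  - apply differentiable_times_plus; auto;
      (apply differentiable_times_mult; auto;
       [apply IH; now apply smooth_on_partial | apply (Hx _ (S n))]).
Qed.

(** * Inverse of a function with nonvanishing derivative *)

Section Inverse.
Variables (D : R -> Prop) (sigma mu : R -> R).
Hypothesis D_open : open D.
Hypothesis D_convex : forall a b c, D a -> D b -> a <= c <= b -> D c.
Hypothesis sigma_derive : forall s, D s -> is_derive sigma s (mu s).
Hypothesis mu_continuous : forall s, D s -> continuous mu s.
Hypothesis mu_neq_0 : forall s, D s -> mu s <> 0.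

Lemma mean_value (a b : R) : D a -> D b ->
  exists c, Rmin a b <= c <= Rmax a b /\ D c /\ sigma b - sigma a = mu c * (b - a).
Proof.
  intros Ha Hb.
  assert (HD : forall c, Rmin a b <= c <= Rmax a b -> D c).
  { intros c. unfold Rmin, Rmax. destruct (Rle_dec a b); eauto. }
  destruct (MVT_gen sigma a b mu) as [c [Hc E]].
  - intros c Hc. apply sigma_derive, HD. lra.
  - intros c Hc. apply continuity_pt_filterlim.
    apply (@ex_derive_continuous R_AbsRing R_NormedModule).
    exists (mu c). apply sigma_derive, HD, Hc.
  - exists c; auto.
Qed.

Lemma injective_of_derive_neq_0 (a b : R) : D a -> D b -> sigma a = sigma b -> a = b.
Proof.
  intros Ha Hb E. destruct (mean_value a b Ha Hb) as [c [_ [Hc Ec]]].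
  assert (H : mu c * (b - a) = 0) by lra.
  apply Rmult_integral in H. destruct H as [H|H]; [now apply mu_neq_0 in H | lra].
Qed.

(** By the intermediate value theorem on a small interval around [s], on which
    [sigma] is strictly monotone. *)
Lemma image_open (U : R -> Prop) :
  open U -> (forall s, U s -> D s) -> open (fun y => exists s, U s /\ sigma s = y).
Proof.
  intros HU HUD y0 [s [Hs Ey]]. subst y0.
  (* Multiplying by [mu s] makes the function increasing near [s], whatever the
     sign of its derivative. *)
  set (e := mu s).
  assert (He : 0 < e * e) by (assert (H := mu_neq_0 s (HUD s Hs)); unfold e; nra).
  assert (Hpos : locally s (fun z => U z /\ 0 < e * mu z)).
  { apply filter_and; [now apply HU|].
    assert (Hc : continuous (fun z => e * mu z) s).
    { apply (@continuous_scal_r R_UniformSpace R_AbsRing R_NormedModule e mu).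
      apply mu_continuous, HUD, Hs. }
    exact (Hc _ (open_gt 0 _ He)). }
  destruct Hpos as [d Hd].
  assert (Hdz : forall z, Rabs (z - s) <= d / 2 -> U z /\ 0 < e * mu z).
  { intros z Hz. apply Hd. unfold ball; simpl; unfold AbsRing_ball, abs, minus, plus, opp; simpl.
    destruct d as [d Hd0]; simpl in *; unfold Rminus in Hz; lra. }
  assert (Hd0 : 0 < d / 2) by (destruct d; simpl; lra).
  set (a := s - d / 2). set (b := s + d / 2).
  assert (HI : forall z, a <= z <= b -> U z /\ 0 < e * mu z).
  { intros z Hz. apply Hdz. unfold a, b in Hz. apply Rabs_le. lra. }
  assert (Inc : forall u v, a <= u -> u < v -> v <= b -> e * sigma u < e * sigma v).
  { intros u v Hu Huv Hv.
    destruct (mean_value u v) as [c [Hc [_ Ec]]];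
      [apply HUD, HI; lra | apply HUD, HI; lra |].
    rewrite Rmin_left, Rmax_right in Hc by lra.
    assert (0 < e * mu c) by (apply HI; lra).
    assert (0 < (e * mu c) * (v - u)) by (apply Rmult_lt_0_compat; lra).
    nra. }
  assert (Ia : e * sigma a < e * sigma s) by (apply Inc; unfold a, b; lra).
  assert (Ib : e * sigma s < e * sigma b) by (apply Inc; unfold a, b; lra).
  assert (Hc : continuous (fun y : R => e * y) (sigma s)).
  { apply (@continuous_scal_r R_UniformSpace R_AbsRing R_NormedModule e (fun y => y)).
    apply continuous_id. }
  generalize (filter_and _ _ (Hc _ (open_gt _ _ Ia)) (Hc _ (open_lt _ _ Ib))).
  unfold filtermap. apply filter_imp. intros y [Hy1 Hy2].
  change (e * sigma a < e * y) in Hy1. change (e * y < e * sigma b) in Hy2.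
  destruct (IVT_interv (fun z => e * sigma z - e * y) a b) as [z [Hz Ez]].
  - intros z Hz. apply derivable_continuous_pt, ex_derive_Reals_0.
    assert (ex_derive sigma z)
      by (exists (mu z); apply sigma_derive, HUD, HI, Hz).
    auto_derive; auto.
  - unfold a, b; lra.
  - lra.
  - lra.
  - exists z. split; [apply HI; lra|].
    apply (Rmult_eq_reg_l e); [lra|]. intros E; rewrite E in He; lra.
Qed.

(** The mean value theorem turns the difference quotient of [tau] into [/ mu c] for
    an intermediate [c], and [c] tends to [s] because images of small balls
    around [s] are neighbourhoods of [sigma s]. *)
Lemma is_derive_inverse (tau : R -> R) (s : R) :
  (forall u, D u -> tau (sigma u) = u) -> D s -> is_derive tau (sigma s) (/ mu s).
Proof.
  intros Htau Hs. split; [apply @is_linear_scal_l|].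
  intros y Hy. rewrite <- (is_filter_lim_locally_unique _ _ Hy). clear y Hy.
  intros eps.
  assert (Hc : continuous (fun z => / mu z) s).
  { apply continuous_comp; [now apply mu_continuous|].
    apply continuity_pt_filterlim, continuity_pt_inv; [apply continuity_pt_id | now apply mu_neq_0]. }
  assert (HU := filter_and _ _ (D_open s Hs) (Hc _ (locally_ball (/ mu s) eps))).
  unfold filtermap in HU. destruct HU as [d Hd].
  assert (Him := image_open (fun z => ball s d z)).
  assert (Hball : open (fun z : R => ball s d z)).
  { intros z Hz. unfold ball in *; simpl in *.
    unfold AbsRing_ball, abs, minus, plus, opp in *; simpl in *.
    assert (Hp : 0 < d - Rabs (z + - s)) by lra.
    exists (mkposreal _ Hp). intros w Hw.
    unfold ball in *; simpl in *; unfold AbsRing_ball, abs, minus, plus, opp in *; simpl in *.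
    replace (w + - s) with ((w + - z) + (z + - s)) by ring.
    eapply Rle_lt_trans; [apply Rabs_triang | lra]. }
  specialize (Him Hball (fun z Hz => proj1 (Hd z Hz))).
  assert (Hloc := Him (sigma s) (ex_intro _ s (conj (ball_center s d) eq_refl))).
  revert Hloc. apply filter_imp. intros y [z [Hz Ez]]. subst y.
  assert (HDz := proj1 (Hd z Hz)).
  rewrite !Htau by auto.
  destruct (mean_value s z Hs HDz) as [c [Hcb [HDc Ec]]].
  assert (Hcd : ball s d c).
  { revert Hz. unfold ball; simpl; unfold AbsRing_ball, abs, minus, plus, opp; simpl.
    intros Hz. eapply Rle_lt_trans; [|exact Hz].
    unfold Rmin, Rmax in Hcb. destruct (Rle_dec s z).
    - rewrite !Rabs_right; lra.
    - rewrite !Rabs_left1; lra. }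
  assert (Hcd2 := proj2 (Hd c Hcd)).
  assert (H0 := mu_neq_0 c HDc).
  change (Rabs (z - s - (sigma z - sigma s) * / mu s)
          <= eps * Rabs (sigma z - sigma s)).
  replace (z - s - (sigma z - sigma s) * / mu s)
    with ((/ mu c - / mu s) * (sigma z - sigma s)).
  2:{ replace (z - s) with (/ mu c * (sigma z - sigma s)); [ring|].
      rewrite Ec; field; auto. }
  rewrite Rabs_mult. apply Rmult_le_compat_r; [apply Rabs_pos|].
  left; exact Hcd2.
Qed.

End Inverse.

(** * Tensors along a curve, chart by chart *)

Lemma coord_vec (f : idx -> R) (k : idx) : coord k (vec f) = f k.
Proof. now destruct k. Qed.

Lemma epsilon_eq (P : R -> Prop) (k : R) :
  P k -> (forall k', P k' -> k' = k) -> epsilon (inhabits 0) P = k.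
Proof. intros Hk Huniq. apply Huniq, epsilon_spec. now exists k. Qed.

Lemma vec_ext (v w : R * R) : (forall k, coord k v = coord k w) -> v = w.
Proof.
  destruct v, w; intros E. f_equal; [exact (E x1) | exact (E x2)].
Qed.

Lemma is_derive_sum2 (f : idx -> R -> R) (s : R) (d : idx -> R) :
  (forall i, is_derive (f i) s (d i)) ->
  is_derive (fun u => sum2 (fun i => f i u)) s (sum2 d).
Proof. intros H. apply @is_derive_plus; apply H. Qed.

Lemma is_derive_Rmult (f h : R -> R) (s df dh : R) :
  is_derive f s df -> is_derive h s dh ->
  is_derive (fun u => f u * h u) s (df * h s + f s * dh).
Proof. intros Hf Hh. apply (is_derive_mult f h); auto. intros; apply Rmult_comm. Qed.

Lemma is_derive_quotient (q n c d : R -> R) (s q' n' c' d' : R) :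
  is_derive q s q' -> is_derive n s n' -> is_derive c s c' -> is_derive d s d' ->
  n s <> 0 -> c s <> 0 ->
  is_derive (fun u => q u * (- d u / (n u ^ 2 * c u ^ 3))) s
    ((- q' * d s - q s * d') / (n s ^ 2 * c s ^ 3)
     + q s * d s * (2 * n' / (n s ^ 3 * c s ^ 3) + 3 * c' / (n s ^ 2 * c s ^ 4))).
Proof.
  intros Hq Hn Hc Hd H1 H2.
  assert (ex_derive q s) by (now exists q'). assert (ex_derive n s) by (now exists n').
  assert (ex_derive c s) by (now exists c'). assert (ex_derive d s) by (now exists d').
  apply is_derive_unique in Hq, Hn, Hc, Hd.
  auto_derive.
  - repeat split; auto. repeat apply Rmult_integral_contrapositive_currified; auto using R1_neq_R0.
  - change (fun x => q x) with q. change (fun x => n x) with n.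
    change (fun x => c x) with c. change (fun x => d x) with d.
    rewrite Hq, Hn, Hc, Hd. field. auto.
Qed.

Lemma is_derive_bilin (h : idx -> idx -> R -> R) (v w : R -> R * R) (s : R)
    (h' : idx -> idx -> R) (v' w' : R * R) :
  (forall i j, is_derive (h i j) s (h' i j)) ->
  (forall i, is_derive (fun u => coord i (v u)) s (coord i v')) ->
  (forall i, is_derive (fun u => coord i (w u)) s (coord i w')) ->
  is_derive (fun u => bilin (fun i j => h i j u) (v u) (w u)) s
    (bilin h' (v s) (w s) + bilin (fun i j => h i j s) v' (w s)
     + bilin (fun i j => h i j s) (v s) w').
Proof.
  intros Hh Hv Hw. evar_last.
  - unfold bilin. apply is_derive_sum2; intros i. apply is_derive_sum2; intros j.
    apply is_derive_Rmult; [apply is_derive_Rmult|]; auto.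
  - unfold bilin, sum2; simpl. ring.
Qed.

Lemma smooth_sum2 (U : R -> Prop) (f : idx -> R -> R) :
  open U -> (forall i, smooth U (f i)) -> smooth U (fun s => sum2 (fun i => f i s)).
Proof. intros HU Hf; now apply smooth_plus. Qed.

Definition smooth_field (U : R -> Prop) (V : R -> R * R) : Prop :=
  forall k, smooth U (fun s => coord k (V s)).

Section AlongCurve.
Context {M : Type} {A : oriented_atlas M}.
Variables (g : pseudo_metric A) (nabla : affine_connection A).
Hypothesis hLC : levi_civita g nabla.
Variables (D : R -> Prop) (alpha : R -> M).
Hypothesis D_open : open D.
Hypothesis alpha_smooth : smooth_curve (A := A) D alpha.

(** All regularity statements are made on these open sets of times; they cover [D],
    and on each of them the curve is an honest plane curve. *)
Definition chart_times (a : index A) (s : R) : Prop := D s /\ dom A a (alpha s).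

Definition pos (a : index A) (s : R) : R * R := chart A a (alpha s).

Lemma chart_image_open (a : index A) : open (chart_image A a).
Proof.
  apply (open_ext (overlap A a a)); [|exact (@overlap_open M A a a)].
  intros x; split; intros [p H]; exists p; tauto.
Qed.

Lemma dom_is_open (a : index A) : is_open A (dom A a).
Proof. intros b. exact (@overlap_open M A b a). Qed.

Lemma chart_times_open (a : index A) : open (chart_times a).
Proof.
  intros s [Hs Ha]. apply filter_and; [now apply D_open|].
  now apply (proj1 alpha_smooth (dom A a) s (dom_is_open a)).
Qed.

Lemma pos_in_image (a : index A) (s : R) : chart_times a s -> chart_image A a (pos a s).
Proof. intros [_ H]; exists (alpha s); auto. Qed.

Lemma pos_smooth (a : index A) : smooth_field (chart_times a) (pos a).
Proof.
  intros k. apply ex_derive_n_smooth. intros n s [Hs Ha].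
  now apply (proj2 alpha_smooth).
Qed.

Lemma smooth_at_pos (a : index A) (f : R * R -> R) :
  smooth_on (chart_image A a) f -> smooth (chart_times a) (fun s => f (pos a s)).
Proof.
  intros Hf. apply (smooth_comp_plane (chart_image A a));
    auto using chart_image_open, chart_times_open, pos_in_image.
  apply pos_smooth.
Qed.

Lemma is_derive_pos (a : index A) (s : R) (k : idx) : chart_times a s ->
  is_derive (fun u => coord k (pos a u)) s (coord k (velocity (A := A) alpha a s)).
Proof.
  intros Hs. unfold velocity. rewrite coord_vec.
  exact (smooth_is_derive _ _ _ (pos_smooth a k) Hs).
Qed.

Lemma velocity_smooth (a : index A) :
  smooth_field (chart_times a) (velocity alpha a).
Proof.
  intros k. apply (smooth_ext _ (chart_times_open a)
                     (Derive (fun u => coord k (pos a u)))).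
  - intros s _. unfold velocity. now rewrite coord_vec.
  - apply smooth_Derive, pos_smooth.
Qed.

Lemma cov_smooth (a : index A) (V : vfield (A := A)) :
  smooth_field (chart_times a) (V a) ->
  smooth_field (chart_times a) (cov nabla alpha V a).
Proof.
  intros HV k. assert (HU := chart_times_open a).
  apply (smooth_ext _ HU (fun s => Derive (fun u => coord k (V a u)) s +
    sum2 (fun i => sum2 (fun j => Gam nabla a k i j (pos a s)
      * coord i (velocity alpha a s) * coord j (V a s))))).
  - intros s _. unfold cov. now rewrite coord_vec.
  - apply smooth_plus; [exact HU | now apply smooth_Derive |].
    apply smooth_sum2; [exact HU | intros i].
    apply smooth_sum2; [exact HU | intros j].
    apply smooth_mult; [exact HU | apply smooth_mult; [exact HU | |] | apply HV].
    + apply smooth_at_pos, Gam_smooth.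
    + apply velocity_smooth.
Qed.

Lemma metric_smooth (a : index A) (V W : R -> R * R) :
  smooth_field (chart_times a) V -> smooth_field (chart_times a) W ->
  smooth (chart_times a) (fun s => metric g a (pos a s) (V s) (W s)).
Proof.
  intros HV HW. assert (HU := chart_times_open a).
  apply smooth_sum2; [exact HU | intros i].
  apply smooth_sum2; [exact HU | intros j].
  apply smooth_mult; [exact HU | apply smooth_mult; [exact HU | |] |]; auto.
  apply smooth_at_pos, g_smooth.
Qed.

(** In an orthonormal basis the Gram determinant is [omega], and a change of
    basis multiplies it by a square. *)
Lemma gram_sign (a : index A) (x : R * R) :
  chart_image A a x -> 0 < omega g * gram g a x.
Proof.
  intros Hx. destruct (g_signature g Hx) as [e1 [e2 [H11 [H12 H22]]]].
  assert (Hs := g_sym g x1 x2 Hx).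
  assert (E : gram g a x * (fst e1 * snd e2 - snd e1 * fst e2) ^ 2 = omega g).
  { replace (omega g) with (sig_diag (sig g) x1 * sig_diag (sig g) x2 - 0 ^ 2)
      by (unfold omega; destruct (sig g); simpl; ring).
    rewrite <- H11, <- H12, <- H22. unfold gram, bilin, sum2; simpl.
    rewrite <- Hs. ring. }
  assert (Ho : omega g * omega g = 1)
    by (unfold omega; destruct (sig g); ring).
  rewrite <- E in Ho at 2.
  assert (0 <= (fst e1 * snd e2 - snd e1 * fst e2) ^ 2) by apply pow2_ge_0.
  destruct (Rlt_or_le 0 (omega g * gram g a x)); [easy | nra].
Qed.

Lemma gram_neq_0 (a : index A) (x : R * R) : chart_image A a x -> gram g a x <> 0.
Proof.
  intros Hx E. assert (H := gram_sign a x Hx). rewrite E in H. lra.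
Qed.

Lemma density_smooth (a : index A) :
  smooth (chart_times a) (fun s => sqrt (Rabs (gram g a (pos a s)))).
Proof.
  assert (HU := chart_times_open a).
  apply smooth_sqrt_Rabs; [exact HU | |].
  - intros s Hs. now apply gram_neq_0, pos_in_image.
  - assert (HG : forall i j, smooth (chart_times a) (fun s => gij g a i j (pos a s)))
      by (intros; apply smooth_at_pos, g_smooth).
    apply (smooth_ext _ HU (fun s => gij g a x1 x1 (pos a s) * gij g a x2 x2 (pos a s)
      + -1 * (gij g a x1 x2 (pos a s) * gij g a x1 x2 (pos a s)))).
    + intros s _; unfold gram; ring.
    + apply smooth_plus; auto using smooth_mult, smooth_const.
Qed.

Lemma vol_smooth (a : index A) (V W : R -> R * R) :
  smooth_field (chart_times a) V -> smooth_field (chart_times a) W ->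
  smooth (chart_times a) (fun s => vol g a (pos a s) (V s) (W s)).
Proof.
  intros HV HW. assert (HU := chart_times_open a).
  apply smooth_mult; [exact HU | apply density_smooth |].
  apply (smooth_ext _ HU (fun s => coord x1 (V s) * coord x2 (W s)
                              + -1 * (coord x2 (V s) * coord x1 (W s)))).
  - intros s _; simpl; ring.
  - apply smooth_plus; auto using smooth_mult, smooth_const.
Qed.

Lemma is_derive_at_pos (a : index A) (f : R * R -> R) (s : R) :
  smooth_on (chart_image A a) f -> chart_times a s ->
  is_derive (fun u => f (pos a u)) s
    (sum2 (fun k => partial k f (pos a s) * coord k (velocity alpha a s))).
Proof.
  intros Hf Hs. apply (chain_rule (chart_image A a));
    auto using chart_image_open, pos_in_image.
  intros k; now apply is_derive_pos.
Qed.

(** The connection terms of the covariant derivatives supply exactly the derivative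
    of [g_ij] along the curve. *)
Lemma is_derive_metric (a : index A) (V W : vfield (A := A)) (s : R) :
  smooth_field (chart_times a) (V a) -> smooth_field (chart_times a) (W a) ->
  chart_times a s ->
  is_derive (fun u => metric g a (pos a u) (V a u) (W a u)) s
    (metric g a (pos a s) (cov nabla alpha V a s) (W a s)
     + metric g a (pos a s) (V a s) (cov nabla alpha W a s)).
Proof.
  intros HV HW Hs. evar_last.
  - apply (is_derive_bilin (fun i j u => gij g a i j (pos a u)) (V a) (W a) s
      (fun i j => sum2 (fun k => partial k (gij g a i j) (pos a s)
                                 * coord k (velocity alpha a s)))
      (vec (fun k => Derive (fun u => coord k (V a u)) s))
      (vec (fun k => Derive (fun u => coord k (W a u)) s))).
    + intros i j. apply is_derive_at_pos; auto. apply g_smooth.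
    + intros i; rewrite coord_vec. exact (smooth_is_derive _ _ _ (HV i) Hs).
    + intros i; rewrite coord_vec. exact (smooth_is_derive _ _ _ (HW i) Hs).
  - unfold metric, cov, bilin, sum2, vec; cbn [coord fst snd]. fold (pos a s).
    rewrite !(proj2 hLC) by (now apply pos_in_image).
    unfold sum2; simpl. ring.
Qed.

(** The derivative of the density [sqrt |G|] is the trace of the connection
    matrix along the curve times the density; that trace is what covariant
    differentiation adds to the derivative of a determinant. *)
Lemma is_derive_vol (a : index A) (V W : vfield (A := A)) (s : R) :
  smooth_field (chart_times a) (V a) -> smooth_field (chart_times a) (W a) ->
  chart_times a s ->
  is_derive (fun u => vol g a (pos a u) (V a u) (W a u)) s
    (vol g a (pos a s) (cov nabla alpha V a s) (W a s)
     + vol g a (pos a s) (V a s) (cov nabla alpha W a s)).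
Proof.
  intros HV HW Hs.
  set (tr := sum2 (fun k => sum2 (fun l => Gam nabla a l k l (pos a s))
                            * coord k (velocity alpha a s))).
  assert (Hx := pos_in_image a s Hs).
  assert (H0 := gram_neq_0 a _ Hx).
  assert (HG : is_derive (fun u => gram g a (pos a u)) s (gram g a (pos a s) * (2 * tr))).
  { assert (HD : forall i j, is_derive (fun u => gij g a i j (pos a u)) s
        (sum2 (fun k => partial k (gij g a i j) (pos a s)
                        * coord k (velocity alpha a s))))
      by (intros; apply is_derive_at_pos; auto; apply g_smooth).
    apply (is_derive_ext (fun u => gij g a x1 x1 (pos a u) * gij g a x2 x2 (pos a u)
      - gij g a x1 x2 (pos a u) * gij g a x1 x2 (pos a u))).
    { intros u; unfold gram; simpl; ring. }
    evar_last.
    - apply @is_derive_minus; apply is_derive_Rmult; apply HD.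
    - unfold gram, tr, sum2; cbn [minus plus opp]; cbn -[partial].
      rewrite !(proj2 hLC) by exact Hx.
      unfold sum2; simpl. rewrite <- (g_sym g x1 x2 Hx). ring. }
  assert (HS := is_derive_sqrt_Rabs _ _ _ HG H0).
  assert (HDV := fun i => smooth_is_derive _ _ _ (HV i) Hs).
  assert (HDW := fun i => smooth_is_derive _ _ _ (HW i) Hs).
  evar_last.
  - unfold vol. apply is_derive_Rmult; [exact HS|].
    apply @is_derive_minus; apply is_derive_Rmult.
    + exact (HDV x1).
    + exact (HDW x2).
    + exact (HDV x2).
    + exact (HDW x1).
  - unfold vol, cov, minus, plus, opp; simpl. fold (pos a s).
    replace (gram g a (pos a s) * (2 * tr) * / (2 * gram g a (pos a s))) with tr
      by (field; exact H0).
    unfold tr, sum2; simpl. ring.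
Qed.

Lemma cov_rescale (a : index A) (f : R -> R) (V : vfield (A := A)) (s f' : R) :
  is_derive f s f' -> (forall k, ex_derive (fun u => coord k (V a u)) s) ->
  cov nabla alpha (rescale f V) a s
  = plus (scal f' (V a s)) (scal (f s) (cov nabla alpha V a s)).
Proof.
  intros Hf HV. apply vec_ext. intros k.
  assert (E : forall u, coord k (rescale f V a u) = f u * coord k (V a u))
    by (now destruct k).
  assert (Ed : Derive (fun u => coord k (rescale f V a u)) s
               = f' * coord k (V a s) + f s * Derive (fun u => coord k (V a u)) s).
  { rewrite (Derive_ext _ _ _ E). apply is_derive_unique.
    apply is_derive_Rmult; [exact Hf | now apply Derive_correct]. }
  unfold cov at 1. rewrite coord_vec, Ed.
  destruct k; unfold rescale, cov, sum2, scal, plus; simpl;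
    unfold scal, plus; simpl; unfold mult; simpl; ring.
Qed.

Lemma rescale_smooth (a : index A) (f : R -> R) (V : vfield (A := A)) :
  smooth (chart_times a) f -> smooth_field (chart_times a) (V a) ->
  smooth_field (chart_times a) (rescale f V a).
Proof.
  intros Hf HV k. apply (smooth_ext _ (chart_times_open a)
                           (fun s => f s * coord k (V a s))).
  - intros s _; now destruct k.
  - apply smooth_mult; auto using chart_times_open.
Qed.

(** * Change of chart *)

(** The differential of the transition map at [x], applied to [v]. *)
Definition push (a b : index A) (x v : R * R) : R * R :=
  vec (fun k => sum2 (fun i => dtrans A a b i k x * coord i v)).

Lemma metric_push (a b : index A) (x u v : R * R) : overlap A a b x ->
  metric g a x u v = metric g b (transition A a b x) (push a b x u) (push a b x v).
Proof.
  intros Hx. unfold metric, bilin.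
  unfold sum2 at 1 2 3. rewrite !(g_tensor g _ _ Hx).
  unfold push, sum2, vec; cbn [coord fst snd]. ring.
Qed.

(** The Gram determinant is multiplied by the square of the Jacobian, whose root is
    the Jacobian itself because charts are positively oriented. *)
Lemma vol_push (a b : index A) (x u v : R * R) : overlap A a b x ->
  vol g a x u v = vol g b (transition A a b x) (push a b x u) (push a b x v).
Proof.
  intros Hx. assert (Hd := transition_oriented Hx). cbv beta zeta in Hd.
  change (0 < dtrans A a b x1 x1 x * dtrans A a b x2 x2 x
              - dtrans A a b x1 x2 x * dtrans A a b x2 x1 x) in Hd.
  assert (Hb : chart_image A b (transition A a b x)).
  { destruct Hx as [p [Ha [Hb Ex]]]. exists p; split; auto.
    unfold transition. now rewrite <- Ex, chartK. }
  assert (E : gram g a x = gram g b (transition A a b x) *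
    (dtrans A a b x1 x1 x * dtrans A a b x2 x2 x
     - dtrans A a b x1 x2 x * dtrans A a b x2 x1 x) ^ 2).
  { unfold gram. rewrite !(g_tensor g _ _ Hx). unfold sum2.
    rewrite <- (g_sym g x1 x2 Hb). ring. }
  unfold vol. rewrite E, Rabs_mult, sqrt_mult by apply Rabs_pos.
  rewrite (Rabs_right (_ ^ 2)) by (apply Rle_ge, pow2_ge_0).
  rewrite sqrt_pow2 by lra.
  unfold push, sum2, vec; cbn [coord fst snd]. ring.
Qed.

Lemma overlap_pos (a b : index A) (s : R) :
  chart_times a s -> chart_times b s -> overlap A a b (pos a s).
Proof. intros [_ Ha] [_ Hb]; exists (alpha s); auto. Qed.

Lemma transition_pos (a b : index A) (s : R) :
  chart_times a s -> transition A a b (pos a s) = pos b s.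
Proof. intros [_ Ha]. unfold transition, pos. now rewrite chartK. Qed.

Lemma is_derive_at_overlap (a b : index A) (f : R * R -> R) (s : R) :
  smooth_on (overlap A a b) f -> chart_times a s -> chart_times b s ->
  is_derive (fun u => f (pos a u)) s
    (sum2 (fun k => partial k f (pos a s) * coord k (velocity alpha a s))).
Proof.
  intros Hf Ha Hb. apply (chain_rule (overlap A a b)); auto using overlap_pos.
  - exact (@overlap_open M A _ _).
  - intros k; now apply is_derive_pos.
Qed.

Lemma velocity_push (a b : index A) (s : R) :
  chart_times a s -> chart_times b s ->
  velocity alpha b s = push a b (pos a s) (velocity alpha a s).
Proof.
  intros Ha Hb. apply vec_ext; intros k.
  unfold velocity at 1, push. rewrite !coord_vec.
  apply is_derive_unique.
  apply (is_derive_ext_loc (fun u => coord k (transition A a b (pos a u)))).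
  - apply (filter_imp (chart_times a)); [|now apply chart_times_open].
    intros u Hu; now rewrite transition_pos.
  - apply (is_derive_at_overlap a b (fun x => coord k (transition A a b x)));
      auto. apply transition_smooth.
Qed.

(** Differentiating [velocity_push] produces second derivatives of the transition
    map; they are the inhomogeneous term of the transformation law of the
    Christoffel symbols. *)
Lemma acceleration_push (a b : index A) (s : R) :
  chart_times a s -> chart_times b s ->
  cov nabla alpha (velocity alpha) b s
  = push a b (pos a s) (cov nabla alpha (velocity alpha) a s).
Proof.
  intros Ha Hb. apply vec_ext; intros k.
  assert (E : Derive (fun u => coord k (velocity alpha b u)) s =
    sum2 (fun j => sum2 (fun i => partial i (dtrans A a b j k) (pos a s)
                                  * coord i (velocity alpha a s))
                   * coord j (velocity alpha a s)
                   + dtrans A a b j k (pos a s)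
                     * Derive (fun u => coord j (velocity alpha a u)) s)).
  { apply is_derive_unique.
    apply (is_derive_ext_loc (fun u => sum2 (fun j =>
             dtrans A a b j k (pos a u) * coord j (velocity alpha a u)))).
    - apply (filter_imp (fun u => chart_times a u /\ chart_times b u)).
      + intros u [Hu Hu']. rewrite (velocity_push a b) by easy.
        unfold push; now rewrite coord_vec.
      + apply filter_and; now apply chart_times_open.
    - apply is_derive_sum2; intros j. apply is_derive_Rmult.
      + apply (is_derive_at_overlap a b); auto.
        apply smooth_on_partial, transition_smooth.
      + exact (smooth_is_derive _ _ _ (velocity_smooth a j) Ha). }
  assert (HG := fun i j => Gam_law nabla k i j (overlap_pos a b s Ha Hb)).
  rewrite (transition_pos a b s Ha) in HG.
  unfold cov at 1. rewrite coord_vec, E. fold (pos b s).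
  rewrite (velocity_push a b s Ha Hb).
  unfold push, cov; rewrite coord_vec. fold (pos a s).
  assert (H11 := HG x1 x1). assert (H12 := HG x1 x2).
  assert (H21 := HG x2 x1). assert (H22 := HG x2 x2). clear HG E.
  unfold sum2, vec in *; cbn [coord fst snd] in *.
  set (X1 := fst (velocity alpha a s)) in *. set (X2 := snd (velocity alpha a s)) in *.
  (* The goal is the transformation law contracted twice with the velocity. *)
  apply (f_equal (fun z => z * (X1 * X1))) in H11.
  apply (f_equal (fun z => z * (X1 * X2))) in H12.
  apply (f_equal (fun z => z * (X2 * X1))) in H21.
  apply (f_equal (fun z => z * (X2 * X2))) in H22.
  lra.
Qed.

Lemma in_preferred_chart (s : R) : D s -> chart_times (chart_at A (alpha s)) s.
Proof. intros Hs; split; [easy | apply chart_at_dom]. Qed.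

Lemma metric_along_chart (a : index A) (s : R) : chart_times a s ->
  metric_along g alpha (velocity alpha) (velocity alpha) s
  = metric g a (pos a s) (velocity alpha a s) (velocity alpha a s).
Proof.
  intros Ha. assert (Hc := in_preferred_chart s (proj1 Ha)).
  unfold metric_along; cbv zeta. fold (pos (chart_at A (alpha s)) s).
  rewrite (metric_push _ a) by (now apply overlap_pos).
  now rewrite <- velocity_push, transition_pos.
Qed.

Lemma vol_along_chart (a : index A) (s : R) : chart_times a s ->
  vol_along g alpha (velocity alpha) (cov nabla alpha (velocity alpha)) s
  = vol g a (pos a s) (velocity alpha a s) (cov nabla alpha (velocity alpha) a s).
Proof.
  intros Ha. assert (Hc := in_preferred_chart s (proj1 Ha)).
  unfold vol_along; cbv zeta. fold (pos (chart_at A (alpha s)) s).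
  rewrite (vol_push _ a) by (now apply overlap_pos).
  now rewrite <- velocity_push, <- acceleration_push, transition_pos.
Qed.

(** * Linear algebra in a chart *)

Lemma metric_plus_r (a : index A) (x u v w : R * R) :
  metric g a x u (plus v w) = metric g a x u v + metric g a x u w.
Proof. unfold metric, bilin, sum2, plus; simpl; unfold plus; simpl; ring. Qed.

Lemma metric_scal_r (a : index A) (x u v : R * R) (k : R) :
  metric g a x u (scal k v) = k * metric g a x u v.
Proof. unfold metric, bilin, sum2, scal; simpl; unfold scal; simpl; unfold mult; simpl; ring. Qed.

Lemma metric_scal_l (a : index A) (x u v : R * R) (k : R) :
  metric g a x (scal k u) v = k * metric g a x u v.
Proof. unfold metric, bilin, sum2, scal; simpl; unfold scal; simpl; unfold mult; simpl; ring. Qed.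

Lemma metric_sym (a : index A) (x u v : R * R) : chart_image A a x ->
  metric g a x u v = metric g a x v u.
Proof.
  intros Hx. unfold metric, bilin, sum2; simpl. rewrite (g_sym g x1 x2 Hx). ring.
Qed.

Lemma vol_plus_r (a : index A) (x u v w : R * R) :
  vol g a x u (plus v w) = vol g a x u v + vol g a x u w.
Proof. unfold vol, plus; simpl; unfold plus; simpl; ring. Qed.

Lemma vol_scal_r (a : index A) (x u v : R * R) (k : R) :
  vol g a x u (scal k v) = k * vol g a x u v.
Proof. unfold vol, scal; simpl; unfold scal; simpl; unfold mult; simpl; ring. Qed.

Lemma vol_antisym (a : index A) (x u v : R * R) :
  vol g a x u v = - vol g a x v u.
Proof. unfold vol; ring. Qed.

Lemma vol_self (a : index A) (x u : R * R) : vol g a x u u = 0.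
Proof. unfold vol; ring. Qed.

Lemma omega_sqr : omega g * omega g = 1.
Proof. unfold omega; destruct (sig g); ring. Qed.

Lemma density_sqr (a : index A) (x : R * R) : chart_image A a x ->
  sqrt (Rabs (gram g a x)) ^ 2 = omega g * gram g a x.
Proof.
  intros Hx. rewrite pow2_sqrt by apply Rabs_pos.
  assert (H := gram_sign a x Hx).
  rewrite <- (Rabs_right (omega g * gram g a x)) by lra.
  rewrite Rabs_mult. unfold omega; destruct (sig g);
    rewrite ?Rabs_R1, ?Rabs_m1; ring.
Qed.

Lemma gram_identity (a : index A) (x u v : R * R) : chart_image A a x ->
  metric g a x u u * metric g a x v v - metric g a x u v ^ 2
  = omega g * vol g a x u v ^ 2.
Proof.
  intros Hx. unfold vol. rewrite Rpow_mult_distr, density_sqr by exact Hx.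
  rewrite <- !Rmult_assoc, omega_sqr.
  unfold metric, bilin, gram, sum2; simpl. rewrite <- (g_sym g x1 x2 Hx). ring.
Qed.

(** A vector is determined by its products with one non-null vector [u]: when
    [vol u d = 0] the vector [d] is a multiple of [u], and
    [g(u,u) d = g(u,d) u]. *)
Lemma vector_ext (a : index A) (x u v w : R * R) : chart_image A a x ->
  metric g a x u u <> 0 ->
  metric g a x u v = metric g a x u w -> vol g a x u v = vol g a x u w -> v = w.
Proof.
  intros Hx Hu Hm Hv.
  assert (Hr : sqrt (Rabs (gram g a x)) <> 0).
  { apply Rgt_not_eq, sqrt_lt_R0, Rabs_pos_lt. now apply gram_neq_0. }
  unfold vol in Hv. apply (Rmult_eq_reg_l _ _ _ ) in Hv; [|exact Hr].
  destruct u as [u1 u2], v as [v1 v2], w as [w1 w2].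
  unfold metric, bilin, sum2 in *; simpl in *.
  revert Hm Hu. generalize (gij g a x1 x1 x) (gij g a x1 x2 x)
    (gij g a x2 x1 x) (gij g a x2 x2 x). intros g11 g12 g21 g22 Hm Hu.
  assert (E : u1 * (v2 - w2) = u2 * (v1 - w1)) by lra.
  assert (F : u1 * (g11 * (v1 - w1) + g12 * (v2 - w2))
              + u2 * (g21 * (v1 - w1) + g22 * (v2 - w2)) = 0) by lra.
  f_equal; apply Rminus_diag_uniq; apply (Rmult_eq_reg_l _ _ _) with (2 := Hu).
  - transitivity (u1 * (u1 * (g11 * (v1 - w1) + g12 * (v2 - w2))
              + u2 * (g21 * (v1 - w1) + g22 * (v2 - w2)))
       - (g12 * u1 + g22 * u2) * (u1 * (v2 - w2) - u2 * (v1 - w1))); [ring|].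
    rewrite E, F; ring.
  - transitivity (u2 * (u1 * (g11 * (v1 - w1) + g12 * (v2 - w2))
              + u2 * (g21 * (v1 - w1) + g22 * (v2 - w2)))
       + (g11 * u1 + g21 * u2) * (u1 * (v2 - w2) - u2 * (v1 - w1))); [ring|].
    rewrite E, F; ring.
Qed.

Lemma Jop_spec (a : index A) (x u v : R * R) : chart_image A a x ->
  metric g a x u (Jop g a x v) = vol g a x u v.
Proof.
  intros Hx. revert u. unfold Jop. apply epsilon_spec.
  assert (H0 := gram_neq_0 a x Hx).
  exists (scal (sqrt (Rabs (gram g a x)) / gram g a x)
    (gij g a x2 x2 x * snd v + gij g a x1 x2 x * fst v,
     - (gij g a x1 x1 x * fst v + gij g a x1 x2 x * snd v))).
  intros u. rewrite metric_scal_r.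
  unfold vol. apply (Rmult_eq_reg_r (gram g a x)); [|exact H0].
  unfold Rdiv. rewrite !Rmult_assoc, (Rmult_comm (/ gram g a x)), !Rmult_assoc.
  rewrite Rinv_r, Rmult_1_r by exact H0. f_equal.
  unfold metric, bilin, gram, sum2; simpl. rewrite <- (g_sym g x1 x2 Hx). ring.
Qed.

(** Since [J u] is orthogonal to [u], the Gram identity of [u] and [J u] reads
    [- g(u,u) V = omega V^2] for [V = Omega(u, J u)], and [V] cannot vanish. *)
Lemma vol_Jop (a : index A) (x u : R * R) : chart_image A a x ->
  metric g a x u u <> 0 -> vol g a x u (Jop g a x u) = - omega g * metric g a x u u.
Proof.
  intros Hx Hu. set (V := vol g a x u (Jop g a x u)).
  assert (Ho : metric g a x u (Jop g a x u) = 0) by (rewrite Jop_spec, vol_self; auto).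
  assert (E : - metric g a x u u * V = omega g * V ^ 2).
  { unfold V at 2. rewrite <- gram_identity, Ho by exact Hx.
    rewrite (Jop_spec a x (Jop g a x u) u), vol_antisym by exact Hx.
    fold V; ring. }
  destruct (Req_dec V 0) as [HV | HV].
  - exfalso.
    assert (HJ : Jop g a x u = scal 0 u).
    { apply (vector_ext a x u); auto.
      - rewrite Ho, metric_scal_r; ring.
      - fold V. rewrite HV, vol_scal_r; ring. }
    assert (Hz : vol g a x (- snd u, fst u) u = 0)
      by (rewrite <- Jop_spec, HJ, metric_scal_r by exact Hx; ring).
    assert (Hr : sqrt (Rabs (gram g a x)) <> 0).
    { apply Rgt_not_eq, sqrt_lt_R0, Rabs_pos_lt. now apply gram_neq_0. }
    unfold vol in Hz. apply Rmult_integral in Hz. destruct Hz as [Hz|Hz]; [easy|].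
    simpl in Hz. apply Hu. 
    assert (E1 : fst u = 0) by nra. assert (E2 : snd u = 0) by nra.
    unfold metric, bilin, sum2; simpl. rewrite E1, E2; ring.
  - apply (Rmult_eq_reg_r V); [|exact HV].
    apply (Rmult_eq_reg_l (omega g)).
    + replace (omega g * (V * V)) with (omega g * V ^ 2) by ring.
      rewrite <- E. transitivity (- (omega g * omega g) * metric g a x u u * V).
      * rewrite omega_sqr; ring.
      * ring.
    + intros H; assert (H' := omega_sqr); rewrite H in H'; lra.
Qed.

(** * Frenet curvature *)

Hypothesis non_null : forall s, D s ->
  metric_along g alpha (velocity alpha) (velocity alpha) s <> 0.

Definition sq_norm : R -> R := metric_along g alpha (velocity alpha) (velocity alpha).

Definition bending : R -> R :=
  vol_along g alpha (velocity alpha) (cov nabla alpha (velocity alpha)).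

Lemma acceleration_smooth (a : index A) :
  smooth_field (chart_times a) (cov nabla alpha (velocity alpha) a).
Proof. apply cov_smooth, velocity_smooth. Qed.

Lemma sq_norm_smooth (a : index A) : smooth (chart_times a) sq_norm.
Proof.
  apply (smooth_ext _ (chart_times_open a)
    (fun s => metric g a (pos a s) (velocity alpha a s) (velocity alpha a s))).
  - intros s Hs; symmetry; now apply metric_along_chart.
  - apply metric_smooth; apply velocity_smooth.
Qed.

Lemma bending_smooth (a : index A) : smooth (chart_times a) bending.
Proof.
  apply (smooth_ext _ (chart_times_open a)
    (fun s => vol g a (pos a s) (velocity alpha a s)
                (cov nabla alpha (velocity alpha) a s))).
  - intros s Hs; symmetry; now apply vol_along_chart.
  - apply vol_smooth; [apply velocity_smooth | apply acceleration_smooth].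
Qed.

Lemma speed_smooth (a : index A) : smooth (chart_times a) (speed g alpha).
Proof.
  apply smooth_sqrt_Rabs; [apply chart_times_open | | apply sq_norm_smooth].
  intros s [Hs _]; now apply non_null.
Qed.

Lemma speed_pos (s : R) : D s -> 0 < speed g alpha s.
Proof. intros Hs; apply sqrt_lt_R0, Rabs_pos_lt, non_null, Hs. Qed.

Lemma speed_pow4 (s : R) : speed g alpha s ^ 4 = sq_norm s ^ 2.
Proof.
  unfold speed. fold sq_norm.
  replace (sqrt (Rabs (sq_norm s)) ^ 4) with ((sqrt (Rabs (sq_norm s)) ^ 2) ^ 2) by ring.
  rewrite pow2_sqrt by apply Rabs_pos. apply pow2_abs.
Qed.

Lemma is_derive_sq_norm (a : index A) (s : R) : chart_times a s ->
  is_derive sq_norm s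
    (2 * metric g a (pos a s) (velocity alpha a s)
           (cov nabla alpha (velocity alpha) a s)).
Proof.
  intros Hs. apply (is_derive_ext_loc
    (fun u => metric g a (pos a u) (velocity alpha a u) (velocity alpha a u))).
  - apply (filter_imp (chart_times a)); [|now apply chart_times_open].
    intros u Hu; symmetry; now apply metric_along_chart.
  - evar_last; [apply is_derive_metric; auto using velocity_smooth|].
    rewrite (metric_sym a _ (cov _ _ _ _ _)) by now apply pos_in_image.
    simpl; ring.
Qed.

(** Both sides are half the derivative of [g(alpha', alpha') = +- speed^2]. *)
Lemma metric_velocity_acceleration (a : index A) (s : R) : chart_times a s ->
  metric g a (pos a s) (velocity alpha a s) (cov nabla alpha (velocity alpha) a s)
  = sq_norm s * (Derive (speed g alpha) s / speed g alpha s).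
Proof.
  intros Hs.
  assert (Hn := speed_pos s (proj1 Hs)).
  assert (Hq := non_null s (proj1 Hs)). fold sq_norm in Hq.
  assert (Dn := is_derive_sqrt_Rabs _ _ _ (is_derive_sq_norm a s Hs) Hq).
  apply is_derive_unique in Dn. fold (speed g alpha s) in Dn.
  change (Derive (speed g alpha) s = speed g alpha s *
    (2 * metric g a (pos a s) (velocity alpha a s)
           (cov nabla alpha (velocity alpha) a s) * / (2 * sq_norm s))) in Dn.
  rewrite Dn. field. split; lra.
Qed.

(** Both [nabla_T T] and the normal are [g]-orthogonal to [alpha'], and their
    [Omega]-products with [alpha'] are [w / nu^2] and [nu]. *)
Lemma frenet_curvature_eq (s : R) : D s ->
  frenet_curvature g nabla alpha s = bending s / speed g alpha s ^ 3.
Proof.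
  intros Hs.
  set (n := speed g alpha s). set (n' := Derive (speed g alpha) s).
  assert (Hn : 0 < n) by now apply speed_pos.
  assert (Hq := non_null s Hs). fold sq_norm in Hq.
  assert (H4 : n ^ 4 = sq_norm s ^ 2) by apply speed_pow4.
  (* The tangent as a multiple of the velocity has squared norm [q / nu^2]. *)
  assert (Heps : causal_sign g alpha s = sq_norm s / n ^ 2).
  { unfold causal_sign, metric_along, tangent, rescale; cbv zeta.
    fold (speed g alpha s); fold n.
    rewrite metric_scal_r, metric_scal_l. 
    unfold sq_norm, metric_along; cbv zeta. field; lra. }
  assert (HN : forall a, chart_times a s ->
    metric g a (pos a s) (velocity alpha a s) (normal g alpha a s) = 0 /\
    vol g a (pos a s) (velocity alpha a s) (normal g alpha a s) = n).
  { intros a Ha. assert (Hx := pos_in_image a s Ha).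
    assert (EX : velocity alpha a s = scal n (tangent g alpha a s)).
    { unfold tangent, rescale. fold n. rewrite scal_assoc.
      unfold mult; simpl. rewrite Rinv_r by lra. symmetry; apply @scal_one. }
    assert (ET : metric g a (pos a s) (tangent g alpha a s) (tangent g alpha a s)
                 = sq_norm s / n ^ 2).
    { unfold tangent, rescale. fold n.
      rewrite metric_scal_r, metric_scal_l, <- metric_along_chart by exact Ha.
      fold sq_norm. field; lra. }
    unfold normal. unfold rescale at 1 2, J_along. fold (pos a s).
    rewrite metric_scal_r, vol_scal_r, Jop_spec, Heps by exact Hx.
    rewrite EX.
    rewrite (vol_antisym a _ (scal n _) (tangent _ _ _ _)).
    rewrite (vol_antisym a _ (scal n _) (Jop _ _ _ _)), !vol_scal_r, vol_self.
    rewrite (vol_antisym a _ (Jop _ _ _ _)), vol_Jop, ET.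
    - split; [ring|].
      transitivity ((omega g * omega g) * (sq_norm s ^ 2 / n ^ 3)); [field; lra|].
      rewrite omega_sqr, <- H4; field; lra.
    - exact Hx.
    - rewrite ET. apply Rmult_integral_contrapositive_currified; [exact Hq|].
      apply Rinv_neq_0_compat; apply pow_nonzero; lra. }
  assert (Hex : eq_at alpha s
      (rescale (fun u => / speed g alpha u) (cov nabla alpha (tangent g alpha)))
      (rescale (fun _ => bending s / n ^ 3) (normal g alpha))).
  { intros a Hd. assert (Ha : chart_times a s) by (split; auto).
    assert (Hx := pos_in_image a s Ha).
    assert (Ecov : cov nabla alpha (tangent g alpha) a s =
      plus (scal (- n' / n ^ 2) (velocity alpha a s))
           (scal (/ n) (cov nabla alpha (velocity alpha) a s))).
    { apply (cov_rescale a (fun u => / speed g alpha u) (velocity alpha)).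
      - apply is_derive_inv; [|fold n; lra].
        exact (smooth_is_derive _ _ _ (speed_smooth a) Ha).
      - intros k. exact (smooth_ex_derive _ _ _ (velocity_smooth a k) Ha). }
    apply (vector_ext a (pos a s) (velocity alpha a s)); auto.
    - rewrite <- metric_along_chart by exact Ha. exact Hq.
    - unfold rescale. fold n. rewrite !metric_scal_r, (proj1 (HN a Ha)), Ecov.
      rewrite metric_plus_r, !metric_scal_r, metric_velocity_acceleration by exact Ha.
      rewrite <- metric_along_chart by exact Ha. fold sq_norm n n'. field; lra.
    - unfold rescale. fold n. rewrite !vol_scal_r, (proj2 (HN a Ha)), Ecov.
      rewrite vol_plus_r, !vol_scal_r, vol_self, <- vol_along_chart by exact Ha.
      fold bending. field; lra. }
  apply epsilon_eq; [exact Hex | intros k Hk].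
  assert (Ha := in_preferred_chart s Hs). set (a := chart_at A (alpha s)) in Ha.
  specialize (Hk a (proj2 Ha)). rewrite (Hex a (proj2 Ha)) in Hk.
  apply (f_equal (vol g a (pos a s) (velocity alpha a s))) in Hk.
  unfold rescale in Hk.
  rewrite !vol_scal_r, (proj2 (HN _ Ha)) in Hk.
  apply Rmult_eq_reg_r in Hk; [|lra]. symmetry; exact Hk.
Qed.

(** [x^2 + x z + z^2] is positive unless [x = z = 0]. *)
Lemma cbrt_unique (x y : R) : x ^ 3 = y -> x = cbrt y.
Proof.
  intros H. assert (E := cbrt_pow3 y). rewrite <- H in E at 2.
  set (z := cbrt y) in *. clearbody z.
  assert (F : (x - z) * ((x + z / 2) ^ 2 + 3 / 4 * z ^ 2) = 0) by (simpl in *; lra).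
  apply Rmult_integral in F. destruct F as [F | F]; [lra|].
  assert (0 <= (x + z / 2) ^ 2) by apply pow2_ge_0.
  assert (0 <= z ^ 2) by apply pow2_ge_0.
  assert (Hz : z = 0) by nra. rewrite Hz in *. nra.
Qed.

(** * Equi-affine curvature *)

Hypothesis bent : forall s, D s -> bending s <> 0.

(** In terms of this function all exponents are integers. *)
Definition root_curvature (s : R) : R := cbrt (frenet_curvature g nabla alpha s).

Lemma root_curvature_pow3 (s : R) : D s ->
  root_curvature s ^ 3 * speed g alpha s ^ 3 = bending s.
Proof.
  intros Hs. unfold root_curvature. rewrite cbrt_pow3, frenet_curvature_eq by exact Hs.
  assert (H := speed_pos s Hs). field. lra.
Qed.

Lemma root_curvature_neq_0 (s : R) : D s -> root_curvature s <> 0.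
Proof.
  intros Hs H. apply (bent s Hs). rewrite <- root_curvature_pow3, H by exact Hs. ring.
Qed.

Lemma ea_speed_eq (s : R) : D s ->
  ea_speed g nabla alpha s = speed g alpha s * root_curvature s.
Proof.
  intros Hs. symmetry. apply cbrt_unique. fold bending.
  rewrite <- root_curvature_pow3 by exact Hs. ring.
Qed.

Lemma frenet_curvature_smooth (a : index A) :
  smooth (chart_times a) (frenet_curvature g nabla alpha).
Proof.
  assert (HU := chart_times_open a).
  apply (smooth_ext _ HU (fun s => bending s * / (speed g alpha s *
            (speed g alpha s * speed g alpha s)))).
  - intros s [Hs _]. rewrite frenet_curvature_eq by exact Hs.
    assert (H := speed_pos s Hs). field. lra.
  - apply smooth_mult; [exact HU | apply bending_smooth |].
    apply smooth_inv; [exact HU | |].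
    + intros s [Hs _]. assert (H := speed_pos s Hs).
      repeat apply Rmult_integral_contrapositive_currified; lra.
    + repeat apply smooth_mult; auto using speed_smooth.
Qed.

Lemma root_curvature_smooth (a : index A) : smooth (chart_times a) root_curvature.
Proof.
  apply smooth_cbrt; [apply chart_times_open | | apply frenet_curvature_smooth].
  intros s [Hs _] H. apply (root_curvature_neq_0 s Hs).
  unfold root_curvature. rewrite H. symmetry. apply cbrt_unique. ring.
Qed.

(** [d t / d sigma] as a function of [t]. *)
Definition ea_rate (s : R) : R := / ea_speed g nabla alpha s.

Lemma ea_speed_neq_0 (s : R) : D s -> ea_speed g nabla alpha s <> 0.
Proof. intros Hs; apply cbrt_neq_0, bent, Hs. Qed.

Lemma ea_speed_smooth (a : index A) : smooth (chart_times a) (ea_speed g nabla alpha).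
Proof.
  apply smooth_cbrt; [apply chart_times_open | | apply bending_smooth].
  intros s [Hs _]; now apply bent.
Qed.

Lemma ea_rate_smooth (a : index A) : smooth (chart_times a) ea_rate.
Proof.
  apply smooth_inv; [apply chart_times_open | | apply ea_speed_smooth].
  intros s [Hs _]; now apply ea_speed_neq_0.
Qed.

Definition ea_velocity : vfield (A := A) := rescale ea_rate (velocity alpha).

(** Covariant differentiation with respect to the equi-affine parameter, transported
    to the parameter of [alpha]. *)
Definition ea_derive (V : vfield) : vfield (A := A) := rescale ea_rate (cov nabla alpha V).

Lemma ea_velocity_smooth (a : index A) :
  smooth_field (chart_times a) (ea_velocity a).
Proof. apply rescale_smooth; [apply ea_rate_smooth | apply velocity_smooth]. Qed.

Lemma ea_derive_smooth (a : index A) (V : vfield) :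
  smooth_field (chart_times a) (V a) -> smooth_field (chart_times a) (ea_derive V a).
Proof.
  intros HV. apply rescale_smooth; [apply ea_rate_smooth | now apply cov_smooth].
Qed.

Lemma ea_derive_velocity (a : index A) (s : R) : chart_times a s ->
  ea_derive ea_velocity a s =
  scal (ea_rate s) (plus (scal (Derive ea_rate s) (velocity alpha a s))
    (scal (ea_rate s) (cov nabla alpha (velocity alpha) a s))).
Proof.
  intros Ha. unfold ea_derive. unfold rescale. f_equal.
  apply (cov_rescale a ea_rate (velocity alpha)).
  - exact (smooth_is_derive _ _ _ (ea_rate_smooth a) Ha).
  - intros k. exact (smooth_ex_derive _ _ _ (velocity_smooth a k) Ha).
Qed.

Lemma Derive_ea_rate (s : R) : D s ->
  Derive ea_rate s = - (Derive (speed g alpha) s * root_curvature s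
    + speed g alpha s * Derive root_curvature s)
    / (speed g alpha s * root_curvature s) ^ 2.
Proof.
  intros Hs. assert (Ha := in_preferred_chart s Hs).
  set (a := chart_at A (alpha s)) in Ha.
  apply is_derive_unique.
  apply (is_derive_ext_loc (fun u => / (speed g alpha u * root_curvature u))).
  - apply (filter_imp D); [|now apply D_open].
    intros u Hu. unfold ea_rate. now rewrite ea_speed_eq.
  - apply (is_derive_inv (fun u => speed g alpha u * root_curvature u)).
    + apply is_derive_Rmult.
      * exact (smooth_is_derive _ _ _ (speed_smooth a) Ha).
      * exact (smooth_is_derive _ _ _ (root_curvature_smooth a) Ha).
    + apply Rmult_integral_contrapositive_currified.
      * assert (H := speed_pos s Hs); lra.
      * now apply root_curvature_neq_0.
Qed.

(** The equi-affine curvature, as it comes out of differentiating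
    [metric_velocity_ea_acceleration]. *)
Definition curvature_from_root (s : R) : R :=
  let n := speed g alpha s in
  let c := root_curvature s in
  let c' := Derive root_curvature s in
  (Derive (Derive root_curvature) s - 3 * c' ^ 2 / c
   - Derive (speed g alpha) s * c' / n) / (n ^ 2 * c ^ 3) + omega g * c ^ 4.

Lemma metric_velocity_ea_acceleration (a : index A) (s : R) : chart_times a s ->
  metric g a (pos a s) (velocity alpha a s) (ea_derive ea_velocity a s)
  = sq_norm s * (- Derive root_curvature s / (speed g alpha s ^ 2 * root_curvature s ^ 3)).
Proof.
  intros Ha. assert (Hs := proj1 Ha).
  rewrite ea_derive_velocity, metric_scal_r, metric_plus_r, !metric_scal_r by exact Ha.
  rewrite metric_velocity_acceleration, <- metric_along_chart by exact Ha.
  fold sq_norm. rewrite Derive_ea_rate by exact Hs. unfold ea_rate.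
  rewrite ea_speed_eq by exact Hs.
  assert (H1 := speed_pos s Hs). assert (H2 := root_curvature_neq_0 s Hs).
  field. split; lra.
Qed.

(** The normalization [Omega(beta', beta'') = 1], with [alpha' = mu beta']. *)
Lemma vol_velocity_ea_acceleration (a : index A) (s : R) : chart_times a s ->
  vol g a (pos a s) (velocity alpha a s) (ea_derive ea_velocity a s)
  = ea_speed g nabla alpha s.
Proof.
  intros Ha. assert (Hs := proj1 Ha).
  rewrite ea_derive_velocity, vol_scal_r, vol_plus_r, !vol_scal_r, vol_self by exact Ha.
  rewrite <- vol_along_chart by exact Ha. fold bending.
  rewrite <- (cbrt_pow3 (bending s)). unfold ea_rate.
  change (cbrt (bending s)) with (ea_speed g nabla alpha s).
  assert (H := ea_speed_neq_0 s Hs). field; exact H.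
Qed.


(** Differentiate [Omega(alpha', B2) = mu], where [B2] is the acceleration of the
    reparametrized curve: [Omega(nabla alpha', B2)] is already [mu']. *)
Lemma vol_velocity_ea_jerk (a : index A) (s : R) : chart_times a s ->
  vol g a (pos a s) (velocity alpha a s) (ea_derive (ea_derive ea_velocity) a s) = 0.
Proof.
  intros Ha. assert (Hs := proj1 Ha). assert (H0 := ea_speed_neq_0 s Hs).
  assert (HQ := ea_derive_smooth a _ (ea_velocity_smooth a)).
  assert (D1 := is_derive_vol a _ _ s (velocity_smooth a) HQ Ha).
  apply is_derive_unique in D1.
  rewrite (Derive_ext_loc _ (ea_speed g nabla alpha)) in D1.
  2:{ apply (filter_imp (chart_times a)); [|now apply chart_times_open].
      intros u Hu. now apply vol_velocity_ea_acceleration. }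
  assert (Dr : Derive ea_rate s
               = - Derive (ea_speed g nabla alpha) s / ea_speed g nabla alpha s ^ 2).
  { apply is_derive_unique, is_derive_inv; [|exact H0].
    exact (smooth_is_derive _ _ _ (ea_speed_smooth a) Ha). }
  unfold ea_derive at 1, rescale. rewrite vol_scal_r.
  apply Rmult_eq_0_compat_l.
  rewrite (ea_derive_velocity a s Ha) in D1.
  rewrite vol_scal_r, vol_plus_r, !vol_scal_r, vol_self in D1.
  rewrite (vol_antisym a _ (cov _ _ _ _ _)), <- vol_along_chart, Dr in D1 by exact Ha.
  fold bending in D1. rewrite <- (cbrt_pow3 (bending s)) in D1.
  change (cbrt (bending s)) with (ea_speed g nabla alpha s) in D1.
  unfold ea_rate in D1 at 1.
  replace (Derive (ea_speed g nabla alpha) s) with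
    (/ ea_speed g nabla alpha s *
       (- Derive (ea_speed g nabla alpha) s / ea_speed g nabla alpha s ^ 2
        * - ea_speed g nabla alpha s ^ 3 + ea_rate s * 0)) in D1 at 1
    by (field; exact H0).
  lra.
Qed.

(** Differentiate [metric_velocity_ea_acceleration] and eliminate
    [g(nabla alpha', nabla alpha')] by the Gram identity. *)
Lemma metric_velocity_ea_jerk (a : index A) (s : R) : chart_times a s ->
  metric g a (pos a s) (velocity alpha a s) (ea_derive (ea_derive ea_velocity) a s)
  = - curvature_from_root s * ea_rate s * sq_norm s.
Proof.
  intros Ha. assert (Hs := proj1 Ha). assert (Hx := pos_in_image a s Ha).
  assert (Hn := speed_pos s Hs). assert (Hc := root_curvature_neq_0 s Hs).
  assert (Hq := non_null s Hs). fold sq_norm in Hq.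
  assert (HQ := ea_derive_smooth a _ (ea_velocity_smooth a)).
  assert (D1 := is_derive_metric a _ _ s (velocity_smooth a) HQ Ha).
  assert (D2 : is_derive (fun u => sq_norm u * (- Derive root_curvature u
      / (speed g alpha u ^ 2 * root_curvature u ^ 3))) s
    (metric g a (pos a s) (cov nabla alpha (velocity alpha) a s)
       (ea_derive ea_velocity a s)
     + metric g a (pos a s) (velocity alpha a s)
         (cov nabla alpha (ea_derive ea_velocity) a s))).
  { revert D1. apply is_derive_ext_loc.
    apply (filter_imp (chart_times a)); [|now apply chart_times_open].
    intros u Hu. now apply metric_velocity_ea_acceleration. }
  assert (Dq := is_derive_sq_norm a s Ha).
  rewrite (metric_velocity_acceleration a s Ha) in Dq.
  assert (Dn := smooth_is_derive _ _ _ (speed_smooth a) Ha).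
  assert (Dc := smooth_is_derive _ _ _ (root_curvature_smooth a) Ha).
  assert (Dc' := smooth_is_derive _ _ _ (smooth_Derive _ _ (root_curvature_smooth a)) Ha).
  assert (D3 := is_derive_quotient _ _ _ _ _ _ _ _ _ Dq Dn Dc Dc' (Rgt_not_eq _ _ Hn) Hc).
  apply is_derive_unique in D2. apply is_derive_unique in D3. rewrite D3 in D2. clear D3.
  assert (EY : metric g a (pos a s) (cov nabla alpha (velocity alpha) a s)
                 (cov nabla alpha (velocity alpha) a s)
    = sq_norm s * (Derive (speed g alpha) s / speed g alpha s) ^ 2
      + omega g * root_curvature s ^ 6 * speed g alpha s ^ 2 * sq_norm s).
  { assert (HG := gram_identity a (pos a s) (velocity alpha a s)
                    (cov nabla alpha (velocity alpha) a s) Hx).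
    rewrite <- metric_along_chart, <- vol_along_chart in HG by exact Ha.
    rewrite metric_velocity_acceleration in HG by exact Ha.
    fold sq_norm bending in HG.
    apply (Rmult_eq_reg_l (sq_norm s)); [|exact Hq].
    apply (Rplus_eq_reg_r (- (sq_norm s
      * (Derive (speed g alpha) s / speed g alpha s)) ^ 2)).
    transitivity (omega g * bending s ^ 2); [rewrite <- HG; ring|].
    rewrite <- (root_curvature_pow3 s Hs).
    replace ((root_curvature s ^ 3 * speed g alpha s ^ 3) ^ 2) with
      (root_curvature s ^ 6 * speed g alpha s ^ 2 * speed g alpha s ^ 4) by ring.
    rewrite speed_pow4. ring. }
  rewrite (ea_derive_velocity a s Ha) in D2 at 1.
  rewrite metric_scal_r, metric_plus_r, !metric_scal_r, EY in D2.
  rewrite (metric_sym a _ (cov _ _ _ _ _) (velocity _ _ _) Hx) in D2.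
  rewrite (metric_velocity_acceleration a s Ha), (Derive_ea_rate s Hs) in D2.
  unfold ea_derive at 1, rescale. rewrite metric_scal_r.
  match type of D2 with ?l = ?r + ?x =>
    assert (EG : x = l - r) by (rewrite D2; ring) end.
  rewrite EG. unfold curvature_from_root, ea_rate. rewrite (ea_speed_eq s Hs).
  field. split; lra.
Qed.

Lemma ea_jerk (a : index A) (s : R) : chart_times a s ->
  ea_derive (ea_derive ea_velocity) a s = scal (- curvature_from_root s) (ea_velocity a s).
Proof.
  intros Ha. apply (vector_ext a (pos a s) (velocity alpha a s)).
  - now apply pos_in_image.
  - rewrite <- metric_along_chart by exact Ha. apply non_null, Ha.
  - rewrite metric_velocity_ea_jerk by exact Ha.
    unfold ea_velocity, rescale. rewrite !metric_scal_r.
    rewrite <- metric_along_chart by exact Ha. fold sq_norm. ring.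
  - rewrite vol_velocity_ea_jerk by exact Ha.
    unfold ea_velocity, rescale. rewrite !vol_scal_r, vol_self. ring.
Qed.

Lemma velocity_reparam (a : index A) (tau theta : R -> R) (y : R) :
  chart_times a (tau y) -> is_derive tau y (theta (tau y)) ->
  velocity (A := A) (fun z => alpha (tau z)) a y
  = rescale theta (velocity alpha) a (tau y).
Proof.
  intros Ha Ht. apply vec_ext; intros k. unfold velocity at 1. rewrite coord_vec.
  apply is_derive_unique. evar_last.
  - apply (is_derive_comp (fun u => coord k (pos a u)) tau).
    + now apply is_derive_pos.
    + exact Ht.
  - now destruct k.
Qed.

(** Covariant differentiation is tensorial in the velocity, so reparametrizing only
    multiplies it by the derivative of the new parameter. *)
Lemma cov_reparam (a : index A) (tau theta : R -> R) (y : R) (V W : vfield (A := A)) :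
  chart_times a (tau y) -> is_derive tau y (theta (tau y)) ->
  smooth_field (chart_times a) (W a) ->
  locally y (fun z => V a z = W a (tau z)) ->
  cov nabla (fun z => alpha (tau z)) V a y
  = rescale theta (cov nabla alpha W) a (tau y).
Proof.
  intros Ha Ht HW HVW. apply vec_ext; intros k. unfold cov at 1. rewrite coord_vec.
  assert (E : Derive (fun u => coord k (V a u)) y =
              theta (tau y) * Derive (fun u => coord k (W a u)) (tau y)).
  { apply is_derive_unique.
    apply (is_derive_ext_loc (fun z => coord k (W a (tau z)))).
    - revert HVW. apply filter_imp. intros z Hz; now rewrite Hz.
    - apply (is_derive_comp (fun u => coord k (W a u)) tau); [|exact Ht].
      exact (smooth_is_derive _ _ _ (HW k) Ha). }
  rewrite E, (velocity_reparam a tau theta y Ha Ht), (locally_singleton _ _ HVW).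
  destruct k; unfold rescale, cov, sum2, scal; simpl;
    unfold scal; simpl; unfold mult; simpl; ring.
Qed.

Lemma ea_speed_continuous (s : R) : D s -> continuous (ea_speed g nabla alpha) s.
Proof.
  intros Hs. apply (@ex_derive_continuous R_AbsRing R_NormedModule).
  exact (smooth_ex_derive _ _ _ (ea_speed_smooth _) (in_preferred_chart s Hs)).
Qed.

Hypothesis D_convex : forall x y z, D x -> D y -> x <= z <= y -> D z.

Lemma is_derive_ea_param (t0 s : R) : D t0 -> D s ->
  is_derive (ea_param g nabla alpha t0) s (ea_speed g nabla alpha s).
Proof.
  intros H0 Hs.
  apply (is_derive_RInt (ea_speed g nabla alpha) _ t0); [|now apply ea_speed_continuous].
  apply (filter_imp D); [|now apply D_open].
  intros u Hu. apply (@RInt_correct R_CompleteNormedModule).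
  apply (@ex_RInt_continuous R_CompleteNormedModule).
  intros z Hz. apply ea_speed_continuous. revert Hz.
  unfold Rmin, Rmax; destruct (Rle_dec t0 u); eauto.
Qed.

(** The inverse [tau] of the equi-affine parameter has the derivative [1 / mu], so the
    covariant derivatives along the reparametrized curve at [sigma s] are the
    [ea_derive]s along [alpha] at [s].  These identities are needed near [t], not
    just at [t], because they get differentiated again. *)
Lemma equi_affine_curvature_eq (t0 t : R) : D t0 -> D t ->
  equi_affine_curvature g nabla D alpha t0 t = curvature_from_root t.
Proof.
  intros H0 Ht. unfold equi_affine_curvature.
  set (sigma := ea_param g nabla alpha t0).
  set (tau := fun y => epsilon (inhabits t0) (fun u => D u /\ sigma u = y)).
  change (ea_reparam g nabla D alpha t0) with (fun y => alpha (tau y)).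
  assert (sigma_derive : forall s, D s -> is_derive sigma s (ea_speed g nabla alpha s))
    by (intros; now apply is_derive_ea_param).
  assert (Htau : forall s, D s -> tau (sigma s) = s).
  { intros s Hs.
    assert (Hex : exists u, D u /\ sigma u = sigma s) by now exists s.
    destruct (epsilon_spec (inhabits t0) _ Hex) as [HD HE]. fold (tau (sigma s)) in HD, HE.
    apply (injective_of_derive_neq_0 D sigma (ea_speed g nabla alpha));
      auto using ea_speed_neq_0. }
  assert (Hdtau : forall s, D s -> is_derive tau (sigma s) (ea_rate s)).
  { intros s Hs. apply (is_derive_inverse D sigma (ea_speed g nabla alpha));
      auto using ea_speed_neq_0, ea_speed_continuous. }
  set (beta := fun y => alpha (tau y)).
  assert (Hloc : forall a (P : R -> Prop) s, chart_times a s ->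
    (forall u, chart_times a u -> P (sigma u)) -> locally (sigma s) P).
  { intros a P s Ha HP.
    apply (filter_imp (fun y => exists u, chart_times a u /\ sigma u = y)).
    - intros y [u [Hu <-]]; auto.
    - apply (image_open D sigma (ea_speed g nabla alpha));
        auto using ea_speed_neq_0, ea_speed_continuous, chart_times_open.
      + intros u Hu; apply Hu.
      + now exists s. }
  assert (B1 : forall a s, chart_times a s ->
    velocity (A := A) beta a (sigma s) = ea_velocity a s).
  { intros a s Ha. assert (E := Htau s (proj1 Ha)).
    unfold beta. rewrite (velocity_reparam a tau ea_rate), E; rewrite ?E; auto.
    apply Hdtau, Ha. }
  assert (Bcov : forall a (V W : vfield (A := A)) s, chart_times a s ->
    smooth_field (chart_times a) (W a) ->
    (forall u, chart_times a u -> V a (sigma u) = W a u) ->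
    cov nabla beta V a (sigma s) = ea_derive W a s).
  { intros a V W s Ha HW HVW. assert (E := Htau s (proj1 Ha)).
    unfold beta. rewrite (cov_reparam a tau ea_rate _ V W), E; rewrite ?E; auto.
    - apply Hdtau, Ha.
    - apply (Hloc a); [exact Ha|]. intros u Hu. rewrite Htau by apply Hu. auto. }
  assert (B3 : forall a, chart_times a t ->
    cov nabla beta (cov nabla beta (velocity beta)) a (sigma t)
    = ea_derive (ea_derive ea_velocity) a t).
  { intros a Ha. apply Bcov; auto using ea_derive_smooth, ea_velocity_smooth. }
  assert (Hbeta : beta (sigma t) = alpha t) by (unfold beta; now rewrite Htau).
  assert (Hex : eq_at beta (sigma t) (cov nabla beta (cov nabla beta (velocity beta)))
     (rescale (fun _ => - curvature_from_root t) (velocity beta))).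
  { intros a Hd. rewrite Hbeta in Hd. assert (Ha : chart_times a t) by (split; auto).
    rewrite B3, ea_jerk by exact Ha. unfold rescale at 1. now rewrite B1. }
  apply epsilon_eq; [exact Hex|]. intros k Hk.
  assert (Ha := in_preferred_chart t Ht). set (a := chart_at A (alpha t)) in Ha.
  assert (Hd : dom A a (beta (sigma t))) by (rewrite Hbeta; apply Ha).
  specialize (Hk a Hd). rewrite (Hex a Hd) in Hk. unfold rescale in Hk.
  rewrite B1 in Hk by exact Ha.
  apply (f_equal (metric g a (pos a t) (velocity alpha a t))) in Hk.
  unfold ea_velocity, rescale in Hk. rewrite !metric_scal_r in Hk.
  rewrite <- metric_along_chart in Hk by exact Ha.
  apply Rmult_eq_reg_r in Hk; [lra|].
  apply Rmult_integral_contrapositive_currified; [|now apply non_null].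
  now apply Rinv_neq_0_compat, ea_speed_neq_0.
Qed.

(** With [kappa = c^3] one has [kappa' = 3 c^2 c'] and
    [kappa'' = 6 c c'^2 + 3 c^2 c'']. *)
Lemma curvature_from_root_eq (t : R) : D t ->
  let n := speed g alpha in
  let k := frenet_curvature g nabla alpha in
  curvature_from_root t =
    / (9 * cbrt (k t) ^ 8) *
    (3 * / n t ^ 2 * k t * Derive_n k 2 t
     - 5 * / n t ^ 2 * Derive k t ^ 2
     - 3 * / n t ^ 3 * Derive n t * k t * Derive k t
     + 9 * omega g * k t ^ 4).
Proof.
  intros Ht n k. set (c := root_curvature).
  assert (Ek : forall s, k s = c s ^ 3) by (intros s; symmetry; apply cbrt_pow3).
  assert (Ha := in_preferred_chart t Ht). set (a := chart_at A (alpha t)) in Ha.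
  assert (Dc : forall s, chart_times a s -> is_derive c s (Derive c s))
    by (intros s Hs; exact (smooth_is_derive _ _ _ (root_curvature_smooth a) Hs)).
  assert (Dc' : is_derive (Derive c) t (Derive (Derive c) t))
    by exact (smooth_is_derive _ _ _ (smooth_Derive _ _ (root_curvature_smooth a)) Ha).
  assert (E1 : forall s, chart_times a s -> Derive k s = 3 * c s ^ 2 * Derive c s).
  { intros s Hs. rewrite (Derive_ext _ _ _ Ek). apply is_derive_unique.
    evar_last; [apply is_derive_pow; now apply Dc | simpl; ring]. }
  assert (E2 : Derive_n k 2 t
    = 6 * c t * Derive c t ^ 2 + 3 * c t ^ 2 * Derive (Derive c) t).
  { change (Derive (Derive k) t
      = 6 * c t * Derive c t ^ 2 + 3 * c t ^ 2 * Derive (Derive c) t).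
    rewrite (Derive_ext_loc _ (fun s => (3 * c s ^ 2) * Derive c s)).
    - apply is_derive_unique. evar_last.
      + apply is_derive_Rmult; [apply is_derive_scal, is_derive_pow, (Dc t Ha) | exact Dc'].
      + simpl; ring.
    - apply (filter_imp (chart_times a)); [exact E1 | now apply chart_times_open]. }
  rewrite E2, (E1 t Ha). unfold curvature_from_root.
  change (cbrt (k t)) with (c t). rewrite Ek. fold n c.
  assert (Hn := speed_pos t Ht). assert (Hc := root_curvature_neq_0 t Ht).
  fold n in Hn. fold c in Hc. field. split; lra.
Qed.

End AlongCurve.

Theorem theorem4 :
  forall (M : Type) (A : oriented_atlas M)
    (hHausdorff : hausdorff A) (hCountable : second_countable A)
    (hConnected : connected_space A)
    (g : pseudo_metric A) (nabla : affine_connection A)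
    (hLC : levi_civita g nabla)
    (l r : Rbar) (hlr : Rbar_lt l r) (alpha : R -> M)
    (hsmooth : smooth_curve (A := A) (Rbar_interval l r) alpha)
    (hg : forall t, Rbar_interval l r t ->
       metric_along g alpha (velocity alpha) (velocity alpha) t <> 0)
    (hvol : forall t, Rbar_interval l r t ->
       vol_along g alpha (velocity alpha) (cov nabla alpha (velocity alpha)) t <> 0)
    (t0 t : R) (ht0 : Rbar_interval l r t0) (ht : Rbar_interval l r t),
    let nu := speed g alpha in
    let kr := frenet_curvature g nabla alpha in
    let ka := equi_affine_curvature g nabla (Rbar_interval l r) alpha t0 in
    ka t =
      / (9 * cbrt (kr t) ^ 8) *
      (3 * / nu t ^ 2 * kr t * Derive_n kr 2 t
       - 5 * / nu t ^ 2 * Derive kr t ^ 2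
       - 3 * / nu t ^ 3 * Derive nu t * kr t * Derive kr t
       + 9 * omega g * kr t ^ 4).
Proof.
  intros M A _ _ _ g nabla hLC l r _ alpha hsmooth hg hvol t0 t ht0 ht nu kr ka.
  assert (D_open : open (Rbar_interval l r))
    by (apply open_and; [apply open_Rbar_gt | apply open_Rbar_lt]).
  assert (D_convex : forall x y z, Rbar_interval l r x -> Rbar_interval l r y ->
            x <= z <= y -> Rbar_interval l r z).
  { intros x y z [Hx _] [_ Hy] [Hxz Hzy]. split.
    - exact (Rbar_lt_le_trans l x z Hx Hxz).
    - exact (Rbar_le_lt_trans z y r Hzy Hy). }
  unfold ka. rewrite (equi_affine_curvature_eq g nabla hLC _ alpha D_open hsmooth)
    by assumption.
  now apply (curvature_from_root_eq g nabla hLC _ alpha D_open hsmooth).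
Qed.
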